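(* Let $1\le b\le d$ be fixed integers. Let $(\phi_i)_{i\in\mathbb{N}_0}$ be an orthonormal basis of $L_2([0,1])$ with $\phi_0(u)=1$ for all $u\in[0,1]$, and let $(\lambda(i))_{i\in\mathbb{N}_0}$ be nonnegative numbers satisfying $$\lambda(i)\sim\mu\, i^{-r}(\ln i)^q,\qquad i\to\infty,$$ for some $\mu>0$, $r>1/2$ and $q>-r$. Let $X_{d,b}(t)$, $t\in[0,1]^d$, be the additive random field of order $b$ $$X_{d,b}(t)=\sum_{\mathcal{A}\in\mathcal{D}_b}\ \sum_{k\in\mathbb{N}_0^{\mathcal{A}}}\Big(\prod_{a\in\mathcal{A}}\lambda(k_a)\prod_{a\in\mathcal{A}}\phi_{k_a}(t_a)\Big)\xi_k^{\mathcal{A}},$$ where $(\xi_k^{\mathcal{A}},\ \mathcal{A}\in\mathcal{D}_b,\ k\in\mathbb{N}_0^{\mathcal{A}})$ are non-correlated random variables with mean zero and unit variance. Then there exist a constant $C=C(X_{d,b})$ and a sequence of linear approximation algorithms $(A_n)_{n\ge2}$, where $A_n$ uses $n$ point values, such that for each $n\ge 2$ $$\mathbb{E}\|X_{d,b}-A_nX_{d,b}\|_2^2\le C\, n^{1-2r}(\ln n)^{2b(r+q)-1}.$$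
   Context: $\mathbb{N}_0=\{0,1,2,\dots\}$; $\mathcal{D}_b$ is the collection of all subsets $\mathcal{A}\subset\{1,\dots,d\}$ with exactly $b$ elements; $\mathbb{N}_0^{\mathcal{A}}$ is the set of multi-indices $k=(k_a)_{a\in\mathcal{A}}$ with entries in $\mathbb{N}_0$. $\|\cdot\|_2$ is the norm of $L_2([0,1]^d)$ with Lebesgue measure. The series defining $X_{d,b}$ converges in mean square; $X_{d,b}$ is jointly measurable with sample paths considered as elements of $L_2([0,1]^d)$. A linear approximation algorithm using $n$ point values is a map $Af=\sum_{l=1}^nf(\tau_l)\psi_l$ with fixed non-random points $\tau_l\in[0,1]^d$ and fixed non-random functions $\psi_l\in L_2([0,1]^d)$; these may depend on the distribution of $X_{d,b}$ but not on its realization. The constant $C$ does not depend on $n$. *)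

(* Defs.v *)
From HB Require Import structures.
From mathcomp Require Import all_boot all_order all_algebra finmap.
From mathcomp Require Import all_classical all_reals all_analysis.
From mathcomp.analysis.showcase Require Export summability.

Set Implicit Arguments.
Unset Strict Implicit.
Unset Printing Implicit Defensive.

Import Order.TTheory GRing.Theory Num.Theory.
Import numFieldNormedType.Exports.

Local Open Scope classical_set_scope.
Local Open Scope ring_scope.

(* Functions on [0,1] and [0,1]^d are represented by Borel functions on R and
   on d.-tuple R; the measures below are concentrated on [0,1] and [0,1]^d, so
   that values outside play no role. *)
Definition unit_lebesgue (R : realType) : set R -> \bar R :=
  fun A => lebesgue_measure (A `&` `[0, 1]).

Section unit_lebesgue_probability.
Context (R : realType).

Let restr := mrestr (@lebesgue_measure R) (measurable_itv `[0%R, 1%R]).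

Let unit_lebesgue0 : @unit_lebesgue R set0 = 0%E.
Proof. exact: (measure0 restr). Qed.

Let unit_lebesgue_ge0 A : (0 <= @unit_lebesgue R A)%E.
Proof. exact: (measure_ge0 restr). Qed.

Let unit_lebesgue_sigma_additive : semi_sigma_additive (@unit_lebesgue R).
Proof. exact: (@measure_semi_sigma_additive _ _ _ restr). Qed.

HB.instance Definition _ := isMeasure.Build _ R R (@unit_lebesgue R)
  unit_lebesgue0 unit_lebesgue_ge0 unit_lebesgue_sigma_additive.

Let unit_lebesgue_setT : @unit_lebesgue R setT = 1%E.
Proof.
rewrite /unit_lebesgue setTI lebesgue_measure_itv /=.
by rewrite lte_fin ltr01 oppr0 adde0.
Qed.

HB.instance Definition _ :=
  Measure_isProbability.Build _ _ _ (@unit_lebesgue R) unit_lebesgue_setT.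

End unit_lebesgue_probability.

Definition tuple_cons (R : realType) (d : nat) (p : R * d.-tuple R) :
  d.+1.-tuple R := [tuple of p.1 :: p.2].

Lemma measurable_tuple_cons (R : realType) (d : nat) :
  measurable_fun setT (@tuple_cons R d).
Proof.
exact: (measurable_cons (@measurable_fst _ _ R (d.-tuple R))
  (@measurable_snd _ _ R (d.-tuple R))).
Qed.

HB.instance Definition _ (R : realType) (d : nat) :=
  isMeasurableFun.Build _ _ _ _ (@tuple_cons R d) (@measurable_tuple_cons R d).

(* d-fold product of [unit_lebesgue], hence Lebesgue measure on [0,1]^d *)
Fixpoint cube_lebesgue (R : realType) (d : nat) : probability (d.-tuple R) R :=
  match d with
  | 0 => \d_ [tuple]
  | d'.+1 => distribution (@unit_lebesgue R \x cube_lebesgue R d')%E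
               (@tuple_cons R d')
  end.

Lemma cube_lebesgue_box (R : realType) (d : nat) (B : 'I_d -> set R) :
  (forall a, measurable (B a)) ->
  cube_lebesgue R d [set t | forall a, B a (tnth t a)] =
  (\prod_(a < d) lebesgue_measure (B a `&` `[0%R, 1%R]))%E.
Proof.
elim: d B => [|d IH] B mB.
  rewrite big_ord0 /= diracE mem_set//=.
  by case.
rewrite big_ord_recl /= /distribution /pushforward.
have -> : @tuple_cons R d @^-1` [set t | forall a, B a (tnth t a)] =
    B ord0 `*` [set t | forall a, B (lift ord0 a) (tnth t a)].
  apply/seteqP; split => [[x t] /= H|[x t] /= [H0 H] a].
    split; first exact: (H ord0).
    by move=> a; have := H (lift ord0 a); rewrite tnthS.
  by case: (unliftP ord0 a) => [j ->|->]; rewrite ?tnthS.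
rewrite product_measure1E//.
  by congr (_ * _)%E; exact: (IH (fun a => B (lift ord0 a))).
have -> : [set t : d.-tuple R | forall a, B (lift ord0 a) (tnth t a)] =
    \bigcap_(a in [set: 'I_d]) ((@tnth _ R ^~ a) @^-1` B (lift ord0 a)).
  by apply/seteqP; split => [t H a _|t H a]; [exact: H|exact: (H a I)].
apply: fin_bigcap_measurable => // a _.
rewrite -[X in measurable X]setTI.
exact: measurable_tnth.
Qed.

Definition unit_cube (R : realType) (d : nat) : set (d.-tuple R) :=
  [set t | forall a, tnth t a \in `[0, 1]].

Definition L2_norm (disp : measure_display) (T : measurableType disp)
    (R : realType) (mu : {measure set T -> \bar R}) (f : T -> R) : \bar R :=
  ('N[mu]_2%:E[EFin \o f])%E.

Definition orthonormal_basis (disp : measure_display) (T : measurableType disp)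
    (R : realType) (mu : {measure set T -> \bar R}) (phi : nat -> T -> R) :=
  [/\ forall i, phi i \in Lfun mu 2%:E,
      forall i j, \int[mu]_x (phi i x * phi j x) = (i == j)%:R &
      forall f, f \in Lfun mu 2%:E ->
        L2_norm mu (fun x => f x -
          \sum_(i < n) (\int[mu]_y (f y * phi i y)) * phi i x)
          @[n --> \oo] --> 0%E].

Definition subsets_of_card (d b : nat) := {A : {set 'I_d} | #|A| == b}.

Definition multi_index (d : nat) (A : {set 'I_d}) :=
  {ffun {a : 'I_d | a \in A} -> nat}.

Definition field_index (d b : nat) :=
  {A : subsets_of_card d b & multi_index (val A)}.

HB.instance Definition _ d A := Choice.on (@multi_index d A).
HB.instance Definition _ d b := Choice.on (@subsets_of_card d b).
HB.instance Definition _ d b := Choice.on (@field_index d b).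

Definition field_coef (R : realType) (d b : nat) (lambda : nat -> R)
    (phi : nat -> R -> R) (i : field_index d b) (t : d.-tuple R) : R :=
  let: existT A k := i in
  (\prod_a lambda (k a)) * (\prod_a phi (k a) (tnth t (val a))).

Definition standard_noncorrelated (disp : measure_display)
    (T : measurableType disp) (R : realType) (P : probability T R) (I : eqType)
    (xi : I -> {RV P >-> R}) :=
  [/\ forall i, ('E_P[xi i] = 0)%E, forall i, ('V_P[xi i] = 1)%E &
      forall i j, i != j -> covariance P (xi i) (xi j) = 0%E].

(* Unordered convergence, along the net of finite sets of indices; for
   non-correlated xi it does not depend on the order of summation. *)
Definition mean_square_sum (disp : measure_display) (T : measurableType disp)
    (R : realType) (P : probability T R) (I : choiceType) (c : I -> R)
    (xi : I -> T -> R) (Y : T -> R) :=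
  (fun F : {fset I} =>
     expectation P (fun w => (Y w - \sum_(i <- F) c i * xi i w) ^+ 2))
    @ totally --> 0%E.

(* X is identified with the series at almost every t only: since phi is merely
   in L_2, the series may diverge at exceptional points.  For a jointly
   measurable X this amounts to convergence in L_2 of the product of the
   probability space and [0,1]^d. *)
Definition additive_random_field (disp : measure_display)
    (T : measurableType disp) (R : realType) (P : probability T R) (d b : nat)
    (lambda : nat -> R) (phi : nat -> R -> R)
    (xi : field_index d b -> {RV P >-> R}) (X : T -> d.-tuple R -> R) :=
  measurable_fun [set: T * d.-tuple R] (fun z => X z.1 z.2) /\
  \forall t \ae cube_lebesgue R d,
    mean_square_sum P (field_coef lambda phi ^~ t) xi (X ^~ t).

Record linear_algorithm (R : realType) (d n : nat) := LinearAlgorithm {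
  node : 'I_n -> d.-tuple R;
  weight : 'I_n -> d.-tuple R -> R;
  node_in_cube : forall l, unit_cube (node l);
  weight_L2 : forall l, weight l \in Lfun (cube_lebesgue R d) 2%:E }.

Definition approximation (R : realType) (d n : nat)
    (A : linear_algorithm R d n) (f : d.-tuple R -> R) (t : d.-tuple R) : R :=
  \sum_(l < n) f (node A l) * weight A l t.

Definition mean_square_error (disp : measure_display) (T : measurableType disp)
    (R : realType) (P : probability T R) (d n : nat)
    (X : T -> d.-tuple R -> R) (A : linear_algorithm R d n) : \bar R :=
  (\int[P]_w
     ((L2_norm (cube_lebesgue R d)
        (fun t => (X w t - approximation A (X w) t)%R)) ^+ 2))%E.

(* Main.v *)
Require Import Defs.
From mathcomp Require Import all_boot all_order all_algebra finmap.
From mathcomp Require Import all_classical all_reals all_analysis.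
From mathcomp Require Import measurable_realfun.
From mathcomp Require Import ring lra zify.

Set Implicit Arguments.
Unset Strict Implicit.
Unset Printing Implicit Defensive.

Import Order.TTheory GRing.Theory Num.Theory.
Import numFieldNormedType.Exports.

Local Open Scope classical_set_scope.
Local Open Scope ring_scope.

(** The field is a sum of noncorrelated terms [xi i * c_i(t)], where
    [c_i = sigma_i * E_(ext i)] is a multiple of a tensor product of the basis
    functions: [ext i] pads the multi-index [i] by zeros, which is harmless as
    [phi 0 = 1].  The functions [E_k] are orthonormal on the cube.  By
    noncorrelation the mean square error of a linear algorithm [A] is, up to a
    factor 2, the deterministic quantity
    [\int \sum_i (c_i(t) - A c_i(t))^2 dt]  ([mean_square_error_le]), provided
    that the nodes avoid the null set where the series diverges.

    So a single algorithm has to recover, from point values, countably many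
    functions, of which all but a tail of total squared norm [D] lie in the
    span of [M] orthonormal functions [E_j].  This is done by the Kaczmarz
    iteration: a node [t] changes the coefficient vector [x] of each residual
    by the projection that makes the residual vanish at [t], tail included.
    With [s = \sum_j E_j^2], the new vector [x'] satisfies
    [s(t) |x'|^2 + (\sum_j x_j E_j(t))^2 = s(t) |x|^2 + y(t)^2], [y] being the
    tail part.  Summed over all functions and integrated over [t], this yields
    some node at which the total squared norm [Q] drops to at most
    [(1 - 1 / M) Q + D / M].  Hence [n] nodes, chosen one after the other and
    the same for all functions, leave an error of order
    [D + W (1 - 1 / M)^n]  ([exists_sampling], [exists_algorithm]).

    The second term is negligible once [M <= n / (2 r ln n)].  For the first,
    the tensor products are taken from a weighted hyperbolic cross.  With
    [h(i) = (i + 1)^-1 ln(i + 2)^(q / r)] one has [lambda(i)^2 <= C h(i)^(2 r)];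
    the cross of parameter [T] has [O(T (ln n)^kappa)] elements, where
    [kappa = (q / r + 1) (b - 1)]  ([card_cross_le]), and the sum of
    [\prod h^(2 r)] outside it is [O(T^(1 - 2 r) (ln n)^(2 q + kappa))] up to a
    smaller power of [n]  ([sum_outside_cross_le]).  The constraint on [M]
    allows [T] of order [n (ln n)^-(kappa + 1)], and then [D] is of order
    [n^(1 - 2 r) (ln n)^(2 b (r + q) - 1)].  Keeping [M] below [n] by a factor
    [ln n] costs [(ln n)^(2 r - 1)] compared with the best approximation from
    [n]-dimensional spaces, and the rate of the theorem has room for it. *)

(** * Powers and logarithms *)

(** The exponent may have either sign, which is why both bounds on [y / x]
    enter the constant. *)
Lemma powR_le_comparable (R : realType) (a b e x y : R) :
  0 < a -> 0 < x -> a * x <= y <= b * x ->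
  y `^ e <= (a `^ e + b `^ e) * x `^ e.
Proof.
move=> a0 x0 /andP[axy ybx].
have y0 : 0 < y by apply: lt_le_trans axy; exact: mulr_gt0.
have b0 : 0 < b by rewrite -(pmulr_lgt0 _ x0); exact: lt_le_trans ybx.
have [e0|e0] := leP 0 e.
  apply: (@le_trans _ _ ((b * x) `^ e)).
    by apply: ge0_ler_powR => //; rewrite ?nnegrE ltW// mulr_gt0.
  by rewrite (powRM _ (ltW b0) (ltW x0)) ler_wpM2r ?powR_ge0// lerDr powR_ge0.
apply: (@le_trans _ _ ((a * x) `^ e)).
  rewrite -[e]opprK !(powRN _ (- e)) lef_pV2 ?posrE ?powR_gt0 ?mulr_gt0//.
  by apply: ge0_ler_powR => //; rewrite ?nnegrE ?oppr_ge0 ?mulr_ge0 ?(ltW e0)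
    ?(ltW a0) ?(ltW x0) ?(ltW y0).
by rewrite (powRM _ (ltW a0) (ltW x0)) ler_wpM2r ?powR_ge0// lerDl powR_ge0.
Qed.

Lemma ln_le_powR (R : realType) (e x : R) : 0 < e -> 0 < x ->
  ln x <= e^-1 * x `^ e.
Proof.
move=> e0 x0; rewrite ler_pdivlMl// -ln_powR.
by apply: ltW; apply: ln_sublinear; exact: powR_gt0.
Qed.

Lemma powR_ln_le (R : realType) (e s : R) : 0 < s ->
  exists2 C : R, 0 < C & forall x : R, 2 <= x -> ln x `^ e <= C * x `^ s.
Proof.
move=> s0; have l2 : 0 < ln 2 :> R by rewrite ln_gt0// ltr1n.
pose k : R := s / (`|e| + 1).
have e10 : 0 < `|e| + 1 by rewrite ltr_wpDl.
have k0 : 0 < k by rewrite divr_gt0.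
exists (ln 2 `^ e + k^-1 `^ e); first by rewrite addr_gt0 ?powR_gt0 ?invr_gt0.
move=> x x2; have x0 : 0 < x by apply: lt_le_trans x2.
have x1 : 1 <= x by apply: le_trans x2; rewrite ler1n.
have lx : ln 2 <= ln x by rewrite ler_ln ?posrE.
have lx0 : 0 < ln x by apply: lt_le_trans lx.
have [e0|e0] := leP 0 e.
  apply: (@le_trans _ _ ((k^-1 * x `^ k) `^ e)).
    apply: ge0_ler_powR; rewrite ?nnegrE ?(ltW lx0) ?mulr_ge0 ?invr_ge0
      ?powR_ge0 ?(ltW k0)//.
    exact: ln_le_powR.
  rewrite powRM ?powR_ge0 ?invr_ge0 ?(ltW k0)// -powRrM.
  apply: ler_pM; rewrite ?powR_ge0//; first by rewrite lerDr powR_ge0.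
  apply: ler_powR => //; rewrite /k mulrAC ler_pdivrMr// ler_wpM2l ?(ltW s0)//.
  by rewrite ger0_norm// lerDl.
apply: (@le_trans _ _ (ln 2 `^ e)).
  rewrite -[e]opprK !(powRN _ (- e)) lef_pV2 ?posrE ?powR_gt0//.
  by apply: ge0_ler_powR; rewrite ?nnegrE ?oppr_ge0 ?(ltW e0) ?(ltW l2) ?(ltW lx0).
rewrite -[leLHS]mulr1; apply: ler_pM; rewrite ?powR_ge0//.
  by rewrite lerDl powR_ge0.
by rewrite -[1](powRr0 x); apply: ler_powR => //; exact: ltW.
Qed.

(** * The weights and their sums *)
Section log_weight.
Variable R : realType.
Implicit Types (g s : R) (i n m N : nat).

Lemma ln_nat_gt0 i : 0 < ln i.+2%:R :> R.
Proof. by rewrite ln_gt0// ltr1n. Qed.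

Lemma ln_nat_le (i j : nat) : (0 < i)%N -> (i <= j)%N -> ln i%:R <= ln j%:R :> R.
Proof.
move=> i0 ij; rewrite ler_ln ?posrE ?ltr0n ?ler_nat//; exact: leq_trans ij.
Qed.

(** The shifts by 1 and 2 keep the weight positive at [i = 0] for every [g]. *)
Definition log_weight g i : R := i.+1%:R^-1 * ln i.+2%:R `^ g.

Lemma log_weight_gt0 g i : 0 < log_weight g i.
Proof. by rewrite mulr_gt0 ?invr_gt0 ?ltr0n ?powR_gt0 ?ln_nat_gt0. Qed.

(** Discrete form of [(ln^(g + 1))' = (g + 1) ln^g / x].  The convexity bound
    [y^(g + 1) - x^(g + 1) >= (g + 1) x^(g + 1) (y - x) / y] holds for either
    sign of [g]; replacing [x] by [y] costs [2^(g + 1)], as consecutive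
    logarithms are within a factor 2. *)
Lemma log_weight_step g i : -1 < g ->
  log_weight g i.+1 <=
  2 * 2 `^ (g + 1) / (g + 1) *
  (ln i.+3%:R `^ (g + 1) - ln i.+2%:R `^ (g + 1)).
Proof.
move=> g1; have g10 : 0 < g + 1 by rewrite -ltrBlDr sub0r.
set x : R := ln i.+2%:R; set y : R := ln i.+3%:R.
have x0 : 0 < x := ln_nat_gt0 i; have y0 : 0 < y := ln_nat_gt0 i.+1.
have y2x : y <= 2 * x.
  have -> : 2 * x = ln (i.+2%:R ^+ 2) by rewrite lnXn ?ltr0n// mulr_natl.
  rewrite -natrX ln_nat_le// -addn1 expnS expn1; nia.
have yx : (i.+3%:R)^-1 <= y - x.
  rewrite -lerN2 opprB; apply: (@le_trans _ _ (ln (i.+2%:R / i.+3%:R))).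
    by rewrite ln_div ?posrE ?ltr0n// .
  have -> : i.+2%:R / i.+3%:R = 1 + - i.+3%:R^-1 :> R.
    by rewrite -(natr1 i.+2); field; apply: lt0r_neq0; have := ler0n R i; lra.
  apply: le_ln1Dx; rewrite ltrN2 invf_lt1 ?ltr1n ?ltr0n//.
have step : (g + 1) * x `^ (g + 1) / y * (y - x) <= y `^ (g + 1) - x `^ (g + 1).
  have -> : y `^ (g + 1) = x `^ (g + 1) * (y / x) `^ (g + 1).
    by rewrite -powRM ?divr_ge0 ?ltW// mulrC divfK ?gt_eqF.
  rewrite -[X in _ <= _ - X]mulr1 -mulrBr.
  rewrite [leLHS](_ : _ = x `^ (g + 1) * ((g + 1) * (1 - x / y))); last first.
    by field; rewrite gt_eqF.
  rewrite ler_wpM2l ?powR_ge0// lerBrDl.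
  rewrite /powR gt_eqF ?divr_gt0//; apply: le_trans (expR_ge1Dx _).
  rewrite lerD2l (ler_wpM2l (ltW g10))// -[y / x]invf_div lnV ?posrE ?divr_gt0//.
  have xy0 : 0 < x / y by rewrite divr_gt0.
  have := @le_ln1Dx R (x / y - 1); rewrite [1 + _]addrC subrK ltrBrDl subrr.
  by move=> /(_ xy0); lra.
apply: le_trans (ler_wpM2l _ step); last first.
  by rewrite divr_ge0 ?mulr_ge0 ?powR_ge0// ltW.
rewrite /log_weight -/y.
have -> : 2 * 2 `^ (g + 1) / (g + 1) * ((g + 1) * x `^ (g + 1) / y * (y - x)) =
  (2 * (y - x)) * ((2 * x) `^ (g + 1) / y).
  by rewrite powRM ?(ltW x0)//; field; rewrite !gt_eqF.
apply: ler_pM; rewrite ?invr_ge0 ?powR_ge0 ?ler0n//.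
  apply: le_trans (ler_wpM2l _ yx) => //.
  rewrite -[2]invrK -invfM lef_pV2 ?posrE ?mulr_gt0 ?invr_gt0 ?ltr0n//.
  by rewrite ler_pdivrMl// -natrM ler_nat; nia.
rewrite ler_pdivlMr// -[X in _ * X](powRr1 (ltW y0)) -powRD; last first.
  by rewrite gt_eqF// implybT.
by apply: ge0_ler_powR => //; rewrite ?nnegrE ?ltW ?mulr_gt0.
Qed.

(** The differences of [log_weight_step] telescope.  For [g > -1] the power
    [ln^(g + 1)] is increasing, so that its value at 2 absorbs the first term. *)
Lemma sum_log_weight_le g : -1 < g ->
  exists2 C : R, 0 < C & forall n, (2 <= n)%N ->
    \sum_(i < n) log_weight g i <= C * ln n%:R `^ (g + 1).
Proof.
move=> g1; have g10 : 0 < g + 1 by rewrite -ltrBlDr sub0r.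
set c : R := 2 * 2 `^ (g + 1) / (g + 1).
have c0 : 0 <= c by rewrite divr_ge0 ?mulr_ge0 ?powR_ge0// ltW.
have l20 := ln_nat_gt0 0.
pose C0 := log_weight g 0 / ln 2 `^ (g + 1).
exists (C0 + c * 2 `^ (g + 1)).
  by rewrite ltr_wpDr ?divr_gt0 ?log_weight_gt0 ?powR_gt0// mulr_ge0 ?powR_ge0.
case=> // n n1.
have lnn : ln 2%:R <= ln n.+1%:R :> R by rewrite ln_nat_le.
rewrite big_ord_recl mulrDl lerD//.
  rewrite /C0 -mulrA ler_peMr ?(ltW (log_weight_gt0 _ _))//.
  rewrite mulrC ler_pdivlMr ?powR_gt0// mul1r ge0_ler_powR ?nnegrE ?(ltW g10)//.
    exact: ltW.
  by apply: le_trans lnn; apply: ltW.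
apply: (@le_trans _ _ (\sum_(0 <= i < n) (c *
    (ln i.+3%:R `^ (g + 1) - ln i.+2%:R `^ (g + 1))))).
  by rewrite big_mkord; apply: ler_sum => i _; exact: log_weight_step.
rewrite -mulr_sumr -mulrA ler_wpM2l//.
rewrite (telescope_sumr (fun i => ln i.+2%:R `^ (g + 1) : R))//.
apply: (@le_trans _ _ (ln n.+2%:R `^ (g + 1))).
  by rewrite gerBl powR_ge0.
have l0 : 0 < ln n.+1%:R :> R by apply: lt_le_trans lnn.
rewrite -powRM ?(ltW l0)//.
apply: ge0_ler_powR; rewrite ?nnegrE ?(ltW g10) ?mulr_ge0 ?(ltW l0)//.
  exact: ltW (ln_nat_gt0 _).
have -> : 2 * ln n.+1%:R = ln (n.+1%:R ^+ 2) :> R.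
  by rewrite lnXn ?ltr0n// mulr_natl.
by rewrite -natrX ln_nat_le// expnS expn1; nia.
Qed.

(** Discrete form of [(- x^-s)' = s x^-(s + 1)]. *)
Lemma powR_nat_step s i : 0 < s ->
  i.+2%:R `^ (- (s + 1)) <= s^-1 * (i.+1%:R `^ (- s) - i.+2%:R `^ (- s)) :> R.
Proof.
move=> s0; set x : R := i.+1%:R; set y : R := i.+2%:R.
have x0 : 0 < x by rewrite ltr0n.
have y0 : 0 < y by rewrite ltr0n.
rewrite ler_pdivlMl// opprD powRD; last by rewrite (gt_eqF y0) implybT.
rewrite powR_inv1 ?(ltW y0)//.
have -> : x `^ (- s) = y `^ (- s) * (x / y) `^ (- s).
  by rewrite -powRM ?divr_ge0 ?ltW// mulrC divfK ?gt_eqF.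
rewrite -[X in _ <= _ - X]mulr1 -mulrBr mulrCA ler_wpM2l ?powR_ge0//.
rewrite lerBrDl /powR gt_eqF ?divr_gt0//; apply: le_trans (expR_ge1Dx _).
rewrite lerD2l mulNr -mulrN ler_wpM2l ?(ltW s0)//.
have -> : x / y = 1 + - y^-1.
  by rewrite /x /y -(natr1 i.+1); field; apply: lt0r_neq0; have := ler0n R i; lra.
rewrite lerNr; apply: le_ln1Dx; rewrite ltrN2 invf_lt1 ?ltr1n ?ltr0n//.
Qed.

(** [Y] may be smaller than 1: the first term, at [m = truncn Y], is estimated
    separately, and the others telescope. *)
Lemma sum_powR_tail_le s (Y : R) N : 0 < s -> 0 < Y ->
  \sum_(i < N | Y < i.+1%:R) i.+1%:R `^ (- (s + 1)) <=
  (1 + s^-1) * Y `^ (- s).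
Proof.
move=> s0 Y0; set m := Num.truncn Y.
have /andP[mY Ym] : m%:R <= Y < m.+1%:R by apply: truncn_itv; exact: ltW.
have F0 i : 0 <= (i.+1%:R : R) `^ (- (s + 1)) by exact: powR_ge0.
apply: (@le_trans _ _ (\sum_(m <= i < N) i.+1%:R `^ (- (s + 1)))).
  rewrite big_mkcond -(big_mkord xpredT
    (fun i => if Y < i.+1%:R then i.+1%:R `^ (- (s + 1)) else 0)) /=.
  have [mN|Nm] := leqP m N.
    rewrite (big_cat_nat (leq0n m) mN) /= [X in X + _]big_nat big1 ?add0r.
      by apply: ler_sum => i _; case: ifP.
    move=> i /andP[_ im]; case: ltP => // Yi.
    have := le_lt_trans mY Yi; rewrite ltr_nat ltnS => mi.
    by move: (leq_ltn_trans mi im); rewrite ltnn.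
  rewrite big_nat big1 ?sumr_ge0// => i /andP[_ im]; case: ltP => // Yi.
  have := lt_le_trans Yi (_ : i.+1%:R <= m%:R).
  by rewrite ler_nat (leq_trans im (ltnW Nm)) => /(_ isT); rewrite ltNge mY.
have m1Y : m.+1%:R `^ (- s) <= Y `^ (- s).
  rewrite !powRN lef_pV2 ?posrE ?powR_gt0// ?ltr0n// ge0_ler_powR ?nnegrE ?ler0n//; exact: ltW.
apply: (@le_trans _ _ ((1 + s^-1) * m.+1%:R `^ (- s))); last first.
  by rewrite ler_wpM2l// addr_ge0 ?invr_ge0// ltW.
have [mN|Nm] := ltnP m N; last first.
  by rewrite big_geq// mulr_ge0 ?powR_ge0// addr_ge0 ?invr_ge0// ltW.
rewrite big_ltn// mulrDl mul1r lerD//.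
  by apply: ler_powR; rewrite ?ler1n// lerN2 lerDl.
apply: (@le_trans _ _ (\sum_(m.+1 <= i < N) s^-1 * (i%:R `^ (- s) - i.+1%:R `^ (- s)))).
  rewrite !big_nat; apply: ler_sum => -[//|i] _; exact: powR_nat_step.
rewrite -mulr_sumr ler_wpM2l ?invr_ge0 ?(ltW s0)//.
under eq_bigr do rewrite -opprB.
rewrite sumrN (telescope_sumr (fun i => i%:R `^ (- s) : R))// opprB gerBl.
exact: powR_ge0.
Qed.

End log_weight.

(** * Sums over multi-indices *)
Lemma powR_ge1 (R : realType) (x e : R) : 1 <= x -> 0 <= e -> 1 <= x `^ e.
Proof. by move=> x1 e0; rewrite -(powRr0 x) ler_powR. Qed.

Lemma powR_prod (R : realType) (I : Type) (s : seq I) (P : pred I) (F : I -> R) (e : R) :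
  (forall i, 0 <= F i) ->
  (\prod_(i <- s | P i) F i) `^ e = \prod_(i <- s | P i) F i `^ e.
Proof.
move=> F0; elim: s => [|i s IH]; first by rewrite !big_nil powR1.
rewrite !big_cons; case: ifP => // _; rewrite powRM ?IH ?F0//.
by apply: prodr_ge0 => j _.
Qed.

Lemma sumr_ge_term (R : realType) (I : finType) (P : pred I) (F : I -> R) i :
  P i -> (forall j, P j -> 0 <= F j) -> F i <= \sum_(j | P j) F j.
Proof.
move=> Pi F0; rewrite (bigD1 i)//= lerDl; apply: sumr_ge0 => j /andP[Pj _].
exact: F0.
Qed.

Lemma sum_nat_le_bound (R : realType) (Y : R) N : 0 <= Y ->
  \sum_(i < N) (i.+1%:R <= Y)%R%:R <= Y.
Proof.
move=> Y0; elim: N => [|N IH]; first by rewrite big_ord0.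
rewrite big_ord_recr /=; have [NY|YN] := leP N.+1%:R Y; last by rewrite addr0.
apply: le_trans NY; rewrite -natr1 lerD2r.
apply: (@le_trans _ _ (\sum_(i < N) 1)); last by rewrite sumr_const card_ord.
by apply: ler_sum => i _; rewrite lern1; case: (_ <= _).
Qed.

(** Multi-indices are truncated at [N] to have finite sums; infinite sums are
    recovered from bounds that do not depend on [N]. *)
Section sum_over_multi_indices.
Context (R : realType) (J : finType) (N : nat).
Implicit Types (k : {ffun J -> 'I_N.+1}) (a : J).

Definition set_coord k a i : {ffun J -> 'I_N.+1} :=
  [ffun c => if c == a then i else k c].

(** Summing first over the coordinate [a] with the others fixed.  The summand
    is presented as [G (k a) k], with [G i] insensitive to the coordinate [a],
    because in the applications the coordinate [a] also occurs in a condition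
    that involves the other coordinates. *)
Lemma sum_ffun_coord a (f : nat -> R) (G : nat -> {ffun J -> 'I_N.+1} -> R) (B : R) :
  (forall i k j, G i (set_coord k a j) = G i k) ->
  (forall k, \sum_(i < N.+1) G i k <= B * \prod_(c | c != a) f (k c)) ->
  \sum_(k : {ffun J -> 'I_N.+1}) G (k a) k <= B * (\sum_(i < N.+1) f i) ^+ #|J|.-1.
Proof.
move=> Ginv Gle.
rewrite (partition_big (fun k => set_coord k a ord0) (fun k => k a == ord0)) /=; last first.
  by move=> k _; rewrite ffunE eqxx.
apply: (@le_trans _ _ (\sum_(k : {ffun J -> 'I_N.+1} | k a == ord0)
    B * \prod_(c | c != a) f (k c))).
  apply: ler_sum => k /eqP ka; apply: le_trans (Gle k).
  rewrite (reindex_onto (set_coord k a) (fun k => k a)) /=; last first.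
    move=> k' /eqP <-; apply/ffunP => c; rewrite !ffunE.
    by case: eqP => // ->.
  rewrite (eq_bigl xpredT).
    by under eq_bigr do rewrite Ginv ffunE eqxx.
  move=> i; rewrite ffunE eqxx eqxx andbT; apply/eqP/ffunP => c; rewrite !ffunE.
  by case: eqP => [->|//]; rewrite ka.
rewrite -mulr_sumr le_eqVlt; apply/orP; left; apply/eqP; congr (_ * _).
pose g c (i : 'I_N.+1) := if c == a then (i == ord0)%:R else f i.
transitivity (\sum_(k : {ffun J -> 'I_N.+1}) \prod_c g c (k c)).
  rewrite big_mkcond; apply: eq_bigr => k _.
  rewrite [RHS](bigD1 a)//= {1}/g eqxx; case: eqP => _; last by rewrite mul0r.
  by rewrite mul1r; apply: eq_bigr => c /negPf ca; rewrite /g ca.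
rewrite -(bigA_distr_bigA g) (bigD1 a)//= {1}/g eqxx.
rewrite (bigD1 ord0)//= big1 ?addr0 ?mul1r; last first.
  by move=> i /negPf ->.
rewrite (eq_bigr (fun=> \sum_(i < N.+1) f i)); last first.
  by move=> c /negPf ca; rewrite /g ca.
by rewrite prodr_const; congr (_ ^+ _); rewrite cardC1.
Qed.

End sum_over_multi_indices.

Lemma exists_max_coord (J : finType) (k : J -> nat) : (0 < #|J|)%N ->
  exists a, forall c, (k c <= k a)%N.
Proof.
move=> /card_gt0P[a0 _]; exists [arg max_(a > a0) k a].
by case: arg_maxnP => // a _ + c; apply.
Qed.

(** * Weighted hyperbolic crosses *)
Section weighted_cross.
Context (R : realType) (g : R).
Local Notation h := (@log_weight R g).
Local Notation L i := (ln i.+2%:R : R).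

Lemma log_weight_bounded : exists2 H : R, 1 <= H & forall i, h i <= H.
Proof.
have [C C0 hC] := @powR_ln_le R g 1 ltr01.
exists (1 + C * 2); first by rewrite lerDl mulr_ge0// ltW.
move=> i; apply: (@le_trans _ _ (C * 2)); last by rewrite lerDr.
rewrite /log_weight ler_pdivrMl ?ltr0n//.
apply: (@le_trans _ _ (C * i.+2%:R)).
  by rewrite -[X in _ <= _ * X]powRr1// hC// ler_nat.
by rewrite mulrCA ler_wpM2l ?(ltW C0)// -natrM ler_nat; lia.
Qed.

(** The square absorbs the logarithm when [g < 0]. *)
Lemma log_weight_ge : exists2 c : R, 0 < c <= 1 &
  forall i, c * i.+1%:R ^- 2 <= h i.
Proof.
have [C C0 hC] := @powR_ln_le R (- g) 1 ltr01.
have C20 : 0 < C * 2 by rewrite mulr_gt0.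
exists ((1 + C * 2)^-1).
  by rewrite invr_gt0 addr_gt0//= invf_le1 ?addr_gt0// lerDl ltW.
move=> i; rewrite /log_weight expr2 invfM mulrCA; apply: ler_wpM2l.
  by rewrite invr_ge0.
rewrite -invfM -[g]opprK (powRN _ (- g)) lef_pV2 ?posrE ?powR_gt0 ?ln_nat_gt0//; last first.
  by rewrite mulr_gt0 ?addr_gt0 ?ltr0n.
apply: (le_trans (hC _ _)); first by rewrite ler_nat.
rewrite (powRr1 (ler0n _ _)) mulrDl mul1r; apply: (@le_trans _ _ (C * 2 * i.+1%:R)).
  by rewrite -mulrA ler_wpM2l ?(ltW C0)// -natrM ler_nat; lia.
by rewrite lerDr.
Qed.

(** The condition [1 <= T * \prod_c h (k c)] of a hyperbolic cross, with the
    logarithm in the largest factor dropped.  That factor is bounded directly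
    by the others, so that sums over the largest coordinate are elementary.
    The condition is imposed at each coordinate where the maximum is attained,
    which avoids choosing one. *)
Definition cross (T : R) (J : finType) (k : J -> nat) : bool :=
  [forall a, [forall c, (k c <= k a)%N] ==>
    ((k a).+1%:R <= T * \prod_(c | c != a) h (k c))].

Lemma prod_weight_le (H : R) (J : finType) (k : J -> nat) (a : J) :
  1 <= H -> (forall i, h i <= H) ->
  0 < \prod_(c | c != a) h (k c) <= H ^+ #|J|.
Proof.
move=> H1 hH; rewrite prodr_gt0/=; last by move=> c _; exact: log_weight_gt0.
apply: (@le_trans _ _ (\prod_(c : J | c != a) H)).
  by apply: ler_prod => c _; rewrite hH ltW// log_weight_gt0.
rewrite prodr_const ler_weXn2l//; exact: max_card.
Qed.

(** The largest coordinate bounds all the others, and it is at most [T] times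
    a product of bounded weights. *)
Lemma cross_lt (H T : R) (n : nat) (J : finType) (k : J -> nat) (c : J) :
  1 <= H -> (forall i, h i <= H) -> 0 <= T -> T * H ^+ #|J| <= n%:R ->
  cross T k -> (k c < n)%N.
Proof.
move=> H1 hH T0 Tn /forallP kT.
have [a amax] := exists_max_coord k (ltac:(by apply/card_gt0P; exists c) : (0 < #|J|)%N).
apply: (leq_ltn_trans (amax c)).
have := kT a; rewrite (introT forallP amax) /= => kaT.
rewrite -(ltr_nat R) -natr1 in kaT *.
have /andP[_ hle] := prod_weight_le k a H1 hH.
have : T * \prod_(c0 | c0 != a) h (k c0) <= n%:R.
  by apply: le_trans Tn; rewrite ler_wpM2l.
by move: kaT; lra.
Qed.

(** Each index is counted at a largest coordinate [a]; for given other
    coordinates, [k a] takes at most [T * \prod_(c != a) h (k c)] values. *)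
Lemma card_cross_le (T : R) (J : finType) N : 0 <= T -> (0 < #|J|)%N ->
  #|[pred k : {ffun J -> 'I_N.+1} | cross T (fun c => k c)]|%:R <=
  #|J|%:R * (T * (\sum_(i < N.+1) h i) ^+ #|J|.-1).
Proof.
move=> T0 J0.
pose G a i (k : {ffun J -> 'I_N.+1}) : R :=
  (i.+1%:R <= T * \prod_(c | c != a) h (k c))%R%:R.
apply: (@le_trans _ _ (\sum_(a : J) \sum_(k : {ffun J -> 'I_N.+1}) G a (k a) k)).
  rewrite exchange_big /= -sum1_card natr_sum big_mkcond /=.
  apply: ler_sum => k _; rewrite [leRHS](_ : _ = \sum_a G a (k a) k)//.
  have G0 a : 0 <= G a (k a) k by rewrite /G ler0n.
  case: ifPn => [|_]; last by rewrite sumr_ge0.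
  rewrite inE => /forallP kT.
  have [a amax] := exists_max_coord (fun c => k c : nat) J0.
  rewrite (bigD1 a)//= -[leLHS]addr0 lerD ?sumr_ge0//.
  by have := kT a; rewrite (introT forallP amax) /= /G => ->.
rewrite -[X in X%:R * _]sum1_card natr_sum mulr_suml.
apply: ler_sum => a _; rewrite mul1r.
apply: sum_ffun_coord => [i k j|k].
  rewrite /G; congr ((_ <= _ * _)%R%:R); apply: eq_bigr => c /negPf ca.
  by rewrite ffunE ca.
apply: sum_nat_le_bound; rewrite mulr_ge0// prodr_ge0// => c _.
by rewrite ltW// log_weight_gt0.
Qed.

Section tail.
Context (r : R) (hr : 1 / 2 < r).
Local Notation e := (2 * r * g).
Local Notation eta := (r - 1 / 2).
Local Notation V i := (h i `^ (2 * r)).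

Let eta0 : 0 < eta. Proof. by move: hr; lra. Qed.

Lemma weight_powE i : V i = i.+1%:R `^ (- (2 * r)) * L i `^ e.
Proof.
rewrite /log_weight powRM ?invr_ge0 ?powR_ge0// -powRrM [g * _]mulrC.
by rewrite -powR_inv1// -powRrM mulN1r.
Qed.

Lemma weight_pow_ge0 i : 0 <= V i. Proof. exact: powR_ge0. Qed.

(** [2 * r = 2 * eta + 1]; lowering [2 * eta] to [3 / 2 * eta] absorbs the
    logarithms.  Two coordinates that are at least [n] still contribute
    [n^(- 3 eta)], which is smaller than [n^(1 - 2 r) = n^(- 2 eta)]. *)
Lemma weight_pow_le : exists2 C : R, 0 < C &
  forall i, V i <= C * i.+1%:R `^ (- (3 / 2 * eta + 1)).
Proof.
have he := eta0.
have [C C0 hC] := @powR_ln_le R e (eta / 2) (ltac:(lra)).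
exists (C * 2 `^ (eta / 2)); first by rewrite mulr_gt0 ?powR_gt0.
move=> i; rewrite weight_powE; set s := 3 / 2 * eta + 1.
apply: (@le_trans _ _ (i.+1%:R `^ (- (2 * r)) * (C * (2 * i.+1%:R) `^ (eta / 2)))).
  rewrite ler_wpM2l ?powR_ge0//; apply: (le_trans (hC _ _)).
    by rewrite ler_nat.
  rewrite ler_wpM2l ?(ltW C0)// ge0_ler_powR ?nnegrE ?mulr_ge0//; first lra.
  by rewrite -natrM ler_nat; lia.
rewrite powRM// mulrCA -!mulrA ler_wpM2l ?(ltW C0)// mulrCA ler_wpM2l ?powR_ge0//.
rewrite -powRD; last by rewrite pnatr_eq0 implybT.
by rewrite (_ : _ + _ = - s)// /s; lra.
Qed.

Lemma sum_weight_pow_ge : exists2 C : R, 0 < C & forall n N, (0 < n)%N ->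
  \sum_(i < N | (n <= i)%N) V i <= C * n%:R `^ (- (3 / 2 * eta)).
Proof.
have [C C0 hC] := weight_pow_le.
have s0 : 0 < 3 / 2 * eta by move: hr; lra.
exists (C * (1 + (3 / 2 * eta)^-1)).
  by rewrite mulr_gt0// addr_gt0// invr_gt0.
move=> n N n0.
have := @sum_powR_tail_le R _ n%:R N s0 (ltac:(by rewrite ltr0n)).
rewrite (eq_bigl (fun i : 'I_N => (n <= i)%N)) => [h|i]; last by rewrite ltr_nat.
apply: (@le_trans _ _ (C * \sum_(i < N | (n <= i)%N) i.+1%:R `^ (- (3 / 2 * eta + 1)))).
  by rewrite mulr_sumr; apply: ler_sum => i _; exact: hC.
by rewrite -(mulrA C) (ler_wpM2l (ltW C0)).
Qed.

Lemma sum_weight_pow_bounded : exists2 W : R, 1 <= W & forall N,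
  \sum_(i < N) V i <= W.
Proof.
have [C C0 hC] := sum_weight_pow_ge.
have V0 := weight_pow_ge0.
exists (1 + V 0%N + C) => [|N].
  by rewrite -addrA lerDl addr_ge0 ?(ltW C0).
case: N => [|N]; first by rewrite big_ord0 !addr_ge0// ltW.
rewrite -addrA ler_wpDl// big_ord_recl lerD//.
have := hC 1%N N.+1 (leqnn _); rewrite powR1 mulr1; apply: le_trans.
by rewrite [leRHS]big_mkcond [leRHS]big_ord_recl /= add0r.
Qed.

(** The hypothesis on [Q] says that [ln i] is of order at least [ln n] on the
    range of summation.  It exceeds that order only when [i] is a large multiple
    of [Y <= n], and then [(i.+1 / Y)^eta] pays for it.  So [ln i] may be
    replaced by [ln n] whatever the sign of its exponent, at the cost of half of
    the decay in excess of [(i + 1)^-1]. *)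
Lemma sum_weight_pow_tail_le (cL : R) : 0 < cL -> exists2 C : R, 0 < C &
  forall n N (Y : R) (Q : pred nat), (2 <= n)%N -> 0 < Y <= n%:R ->
    (forall i, Q i -> Y < i.+1%:R -> ln n%:R <= cL * L i) ->
    \sum_(i < N | Q i && (Y < i.+1%:R)) V i <=
      C * (ln n%:R `^ e * Y `^ (1 - 2 * r)).
Proof.
move=> cL0.
have ae0 : 0 < `|e| + 1 by rewrite ltr_wpDl.
pose d := eta / (`|e| + 1).
have d0 : 0 < d by rewrite divr_gt0.
have l20 : 0 < ln 2 :> R by rewrite ln_gt0// ltr1n.
pose B := 2 + (d * ln 2)^-1.
have B0 : 0 < B by rewrite addr_gt0// invr_gt0 mulr_gt0.
pose K := cL^-1 `^ e + B `^ e.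
have K0 : 0 < K by rewrite addr_gt0 ?powR_gt0 ?invr_gt0.
have C0 : 0 < K * (1 + eta^-1) by rewrite mulr_gt0// addr_gt0 ?invr_gt0.
exists (K * (1 + eta^-1)) => // n N Y Q n2 /andP[Y0 Yn] HQ.
have n0 : 0 < n%:R :> R by rewrite ltr0n (leq_trans _ n2).
have ln2n : ln 2 <= ln n%:R :> R by exact: ln_nat_le.
have lnn0 : 0 < ln n%:R :> R by apply: lt_le_trans ln2n.
have key i : Q i -> Y < i.+1%:R ->
    V i <= K * ln n%:R `^ e * (Y `^ (- eta) * i.+1%:R `^ (- (eta + 1))).
  move=> Qi Yi; set x : R := i.+1%:R / Y.
  have x1 : 1 <= x by rewrite ler_pdivlMr// mul1r ltW.
  have x0 : 0 < x by apply: lt_le_trans x1.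
  have Le : L i `^ e <= K * x `^ eta * ln n%:R `^ e.
    have : cL^-1 * ln n%:R <= L i <= B * x `^ d * ln n%:R.
      rewrite ler_pdivrMl// HQ//=.
      apply: (@le_trans _ _ (ln 2 + ln n%:R + ln x)).
        have -> : ln 2 + ln n%:R + ln x = ln (2 * n%:R * x).
          have n20 : 0 < 2 * n%:R :> R by rewrite mulr_gt0.
          by rewrite (@lnM _ (2 * n%:R) x) ?(@lnM _ 2 n%:R) ?posrE.
        have n2x0 : 0 < 2 * n%:R * x by exact: (mulr_gt0 (mulr_gt0 (ltr0Sn _ 1) n0) x0).
        rewrite ler_ln ?posrE ?ltr0n//.
        apply: (@le_trans _ _ (2 * (Y * x))).
          by rewrite /x (mulrC Y) divfK ?gt_eqF// -natrM ler_nat; clear; lia.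
        by rewrite -mulrA ler_wpM2l// ler_wpM2r// ltW.
      have xd1 : 1 <= x `^ d by rewrite powR_ge1// ltW.
      rewrite [leRHS](_ : _ = 2 * ln n%:R * x `^ d + (d * ln 2)^-1 * x `^ d * ln n%:R); last first.
        by rewrite /B; ring.
      apply: lerD.
        apply: (@le_trans _ _ (2 * ln n%:R)); first by lra.
        by rewrite ler_peMr// mulr_ge0// ltW.
      apply: (le_trans (ln_le_powR d0 x0)).
      rewrite [leRHS](_ : _ = d^-1 * x `^ d * (ln n%:R / ln 2)); last first.
        by rewrite invfM; ring.
      rewrite ler_peMr ?mulr_ge0 ?powR_ge0 ?invr_ge0 ?(ltW d0)//.
      by rewrite ler_pdivlMr// mul1r.
    move=> /(powR_le_comparable e (ltac:(by rewrite invr_gt0) : 0 < cL^-1) lnn0).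
    move=> /le_trans; apply; rewrite ler_wpM2r ?powR_ge0// /K [leRHS]mulrDl; apply: lerD.
      by rewrite ler_peMr ?powR_ge0// powR_ge1// (ltW eta0).
    rewrite powRM ?(ltW B0) ?powR_ge0// ler_wpM2l ?powR_ge0// -powRrM ler_powR//.
    rewrite /d mulrAC ler_pdivrMr// ler_wpM2l ?(ltW eta0)//.
    by rewrite (le_trans (ler_norm _))// lerDl.
  rewrite weight_powE.
  apply: (le_trans (ler_wpM2l (powR_ge0 _ _) Le)).
  rewrite /x powRM ?invr_ge0 ?(ltW Y0)// -[Y^-1]powR_inv1 ?(ltW Y0)// -powRrM mulN1r.
  rewrite le_eqVlt; apply/orP; left; apply/eqP.
  have -> : i.+1%:R `^ (- (eta + 1)) = i.+1%:R `^ eta * i.+1%:R `^ (- (2 * r)) :> R.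
    rewrite -powRD; last by rewrite pnatr_eq0 implybT.
    by congr (_ `^ _); lra.
  ring.
apply: (@le_trans _ _ (\sum_(i < N | Y < i.+1%:R)
    K * ln n%:R `^ e * (Y `^ (- eta) * i.+1%:R `^ (- (eta + 1))))).
  rewrite big_mkcond [leRHS]big_mkcond; apply: ler_sum => i _.
  case: ifPn => [/andP[Qi Yi]|_]; first by rewrite Yi key.
  by case: ifP => // _; rewrite !mulr_ge0 ?powR_ge0// ltW.
rewrite -mulr_sumr -mulr_sumr.
have := sum_powR_tail_le N eta0 Y0.
move=> /(ler_wpM2l (powR_ge0 Y (- eta))) /(ler_wpM2l (powR_ge0 (ln n%:R) e)) /(ler_wpM2l (ltW K0)).
rewrite mulrA => /le_trans; apply; rewrite le_eqVlt; apply/orP; left; apply/eqP.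
have -> : Y `^ (1 - 2 * r) = Y `^ (- eta) * Y `^ (- eta).
  rewrite -powRD; last by rewrite (gt_eqF Y0) implybT.
  by congr (_ `^ _); lra.
ring.
Qed.

(** Each of the other weights is at least [c * (i + 1)^-2], since the other
    coordinates are at most [i].  Outside the cross this forces
    [T <= C * (i + 1)^(2 m - 1)], where [T >= n^(1/2)]; take logarithms. *)
Lemma ln_le_of_outside m : (0 < m)%N ->
  exists2 cL : R, 0 < cL & forall (J : finType) n (T : R) (k : J -> nat) a i,
    #|J| = m -> (2 <= n)%N ->
    n%:R `^ 2^-1 <= T -> (forall c, c != a -> (k c <= i)%N) ->
    T * \prod_(c | c != a) h (k c) < i.+1%:R -> ln n%:R <= cL * L i.
Proof.
move=> J0; have [c0 /andP[c00 c01] hc] := log_weight_ge.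
set b : R := m%:R.
have b0 : 0 < b by rewrite ltr0n.
have l20 : 0 < ln 2 :> R by rewrite ln_gt0// ltr1n.
have lc0 : ln c0 <= 0 by exact: ln_le0.
have K0 : 0 <= - ln c0 / ln 2 by rewrite divr_ge0 ?(ltW l20)// oppr_ge0.
exists (b * 4 + 2 * b * (- ln c0 / ln 2)).
  by rewrite ltr_wpDr ?(mulr_gt0 b0)// (mulr_ge0 _ K0)// mulr_ge0// ltW.
move=> J n T k a i Jm n2 nT ki Ti; subst m.
have n0 : 0 < n%:R :> R by rewrite ltr0n (leq_trans _ n2).
have T0 : 0 < T by apply: lt_le_trans nT; exact: powR_gt0.
have i10 : 0 < i.+1%:R :> R by rewrite ltr0n.
have prodge : (c0 * i.+1%:R ^- 2) ^+ #|J|.-1 <= \prod_(c | c != a) h (k c).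
  have -> : (c0 * i.+1%:R ^- 2) ^+ #|J|.-1 =
      \prod_(c : J | c != a) (c0 * i.+1%:R ^- 2).
    by rewrite prodr_const cardC1.
  apply: ler_prod => c ca; rewrite mulr_ge0 ?(ltW c00) ?invr_ge0 ?exprn_ge0//=.
  apply: le_trans (hc _); rewrite ler_wpM2l ?(ltW c00)//.
  rewrite lef_pV2 ?posrE ?exprn_gt0 ?ltr0n// lerXn2r ?nnegrE ?ler0n//.
  by rewrite ler_nat ltnS ki.
have lt1 : T * (c0 * i.+1%:R ^- 2) ^+ #|J|.-1 < i.+1%:R.
  by apply: le_lt_trans Ti; rewrite ler_wpM2l ?(ltW T0).
have q0 : 0 < c0 * i.+1%:R ^- 2 by rewrite mulr_gt0// invr_gt0 exprn_gt0.
have Lge : ln 2 <= L i by rewrite ln_nat_le.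
have li : ln i.+1%:R <= L i by rewrite ln_nat_le.
have li0 : 0 <= ln i.+1%:R :> R by rewrite ln_ge0// ler1n.
have : ln T + (ln c0 - 2 * ln i.+1%:R) * #|J|.-1%:R <= ln i.+1%:R.
  have lnq : ln (c0 * i.+1%:R ^- 2) = ln c0 - 2 * ln i.+1%:R.
    rewrite lnM ?posrE ?invr_gt0 ?exprn_gt0//.
    by rewrite lnV ?posrE ?exprn_gt0// lnXn// mulr_natl.
  move: lt1 => /ltW; rewrite -ler_ln ?posrE ?(mulr_gt0 T0) ?exprn_gt0//.
  by rewrite lnM ?posrE ?exprn_gt0// lnXn// lnq mulr_natr.
have : 2^-1 * ln n%:R <= ln T.
  by rewrite -ln_powR ler_ln ?posrE ?powR_gt0.
have bE : #|J|.-1%:R = b - 1 :> R by rewrite /b -(prednK J0) -natr1 addrK.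
have b1 : 1 <= b by rewrite ler1n.
rewrite bE.
set l := ln n%:R; set t := ln T; set x : R := ln i.+1%:R; set y := ln c0.
move=> h1 h2.
have xb : x + 2 * x * (b - 1) <= b * 2 * L i.
  have : x * (2 * b - 1) <= L i * (2 * b - 1) by rewrite ler_wpM2r//; lra.
  have := le_trans (ltW l20) Lge; lra.
have yb : - y * (b - 1) <= b * (- y / ln 2 * L i).
  have : - y <= - y / ln 2 * L i.
    by rewrite -mulrA ler_peMr ?oppr_ge0// ler_pdivlMl// mulr1.
  move=> /(ler_wpM2l (ltW b0)); have : 0 <= - y by rewrite oppr_ge0.
  lra.
lra.
Qed.

(** The sum is at most a product over the coordinates: two factors are tails
    beyond [n], the others are bounded. *)
Lemma sum_two_large_coords : exists2 C : R, 0 < C &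
  forall (J : finType) (a c : J) (n N : nat), (0 < n)%N -> a != c ->
  \sum_(k : {ffun J -> 'I_N.+1} | (n <= k a)%N && (n <= k c)%N)
     \prod_x V (k x) <= C ^+ #|J| * n%:R `^ (- (3 * eta)).
Proof.
have [C C0 hC] := sum_weight_pow_ge.
have [W W1 hW] := sum_weight_pow_bounded.
have W0 : 0 < W by apply: lt_le_trans W1.
exists (C + W); first by rewrite addr_gt0.
move=> J a c n N n0 ac.
pose G x (i : 'I_N.+1) := if ((x == a) || (x == c)) && (i < n)%N then 0 else V i.
have V0 := weight_pow_ge0.
have G0 x i : 0 <= G x i by rewrite /G; case: ifP.
have Gac x : (x == a) || (x == c) -> \sum_i G x i <= C * n%:R `^ (- (3 / 2 * eta)).
  move=> xac; apply: le_trans (hC n N.+1 n0).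
  rewrite [leRHS]big_mkcond; apply: ler_sum => i _; rewrite /G xac /= ltnNge.
  by case: leqP.
apply: (@le_trans _ _ (\sum_(k : {ffun J -> 'I_N.+1}) \prod_x G x (k x))).
  rewrite big_mkcond; apply: ler_sum => k _.
  case: ifPn => [/andP[nka nkc]|_]; last by apply: prodr_ge0.
  apply: ler_prod => x _; rewrite V0 /= /G; case: ifPn => // /andP[].
  by case/orP => /eqP ->; rewrite ltnNge ?nka ?nkc.
rewrite -(bigA_distr_bigA G).
rewrite (bigD1 a)//= (bigD1 c)/=; last by rewrite eq_sym.
set Z := \prod_(i | _) _.
have Z1 : 0 <= Z <= (C + W) ^+ #|J|.-2.
  apply/andP; split; first by apply: prodr_ge0 => x _; exact: sumr_ge0.
  apply: (@le_trans _ _ (\prod_(x | (x != a) && (x != c)) (C + W))).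
    apply: ler_prod => x _; rewrite sumr_ge0//=.
    apply: (@le_trans _ _ W); last by rewrite lerDr ltW.
    apply: le_trans (hW N.+1); apply: ler_sum => i _; rewrite /G.
    by case: ifP => // _; exact: V0.
  rewrite prodr_const le_eqVlt; apply/orP; left; apply/eqP; congr (_ ^+ _).
  have := cardC [pred x | (x == a) || (x == c)].
  have -> : #|[pred x | (x == a) || (x == c)]| = 2%N.
    by rewrite (eq_card (_ : _ =i pred2 a c))// card2 ac.
  rewrite add2n => <- /=; apply: eq_card => x.
  by rewrite !inE negb_or.
have -> : (C + W) ^+ #|J| * n%:R `^ (- (3 * eta)) =
   ((C + W) * n%:R `^ (- (3 / 2 * eta))) *
   (((C + W) * n%:R `^ (- (3 / 2 * eta))) * (C + W) ^+ #|J|.-2).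
  have J2 : (1 < #|J|)%N.
    by rewrite -[2%N](_ : #|pred2 a c| = _) ?max_card// card2 ac.
  have -> : - (3 * eta) = - (3 / 2 * eta) + - (3 / 2 * eta) by lra.
  rewrite powRD; last by rewrite pnatr_eq0 -lt0n n0 implybT.
  rewrite -[in LHS](prednK (ltnW J2)) -(prednK (_ : 0 < #|J|.-1)%N) ?exprS.
    ring.
  by rewrite -ltnS prednK// ltnW.
have D := powR_ge0 (n%:R : R) (- (3 / 2 * eta)).
have CW : C * n%:R `^ (- (3 / 2 * eta)) <= (C + W) * n%:R `^ (- (3 / 2 * eta)).
  by rewrite ler_wpM2r// lerDl ltW.
case/andP: Z1 => Z0 Z1.
apply: ler_pM => //; first by apply: sumr_ge0.
- by rewrite mulr_ge0 ?sumr_ge0.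
- by apply: le_trans CW; apply: Gac; rewrite eqxx.
apply: ler_pM => //; first by apply: sumr_ge0.
by apply: le_trans CW; apply: Gac; rewrite eqxx orbT.
Qed.

(** The largest coordinate of an index outside the cross is summed first: this
    leaves a sum of [h] over the other coordinates, because
    [h^(2 r) * h^(1 - 2 r) = h].  If they are all below [n], that sum is
    logarithmic in [n]; otherwise the index has two coordinates that are at
    least [n], and the crude bound on such indices suffices. *)
Lemma sum_outside_cross_le (H : R) m :
  1 <= H -> (forall i, h i <= H) -> (0 < m)%N ->
  exists2 C : R, 0 < C & forall (J : finType) n (T : R) N,
    #|J| = m -> (2 <= n)%N ->
    n%:R `^ 2^-1 <= T -> T * H ^+ #|J| <= n%:R ->
    \sum_(k : {ffun J -> 'I_N.+1} | ~~ cross T (fun c => k c))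
       \prod_c V (k c) <=
    C * (ln n%:R `^ e * T `^ (1 - 2 * r) * (\sum_(i < n) h i) ^+ #|J|.-1
         + n%:R `^ (- (3 * eta))).
Proof.
move=> H1 hH J0.
have [cL cL0 hcL] := ln_le_of_outside J0.
have [C C0 hC] := sum_weight_pow_tail_le cL0.
have [D D0 hD] := sum_two_large_coords.
set b : R := m%:R.
have b0 : 0 < b by rewrite ltr0n.
have DJ0 : 0 < D ^+ m by exact: exprn_gt0.
exists (b * C + b * (b * D ^+ m)); first by rewrite addr_gt0 ?mulr_gt0.
move=> J n T N Jm n2 nT Tn; subst m.
have n0 : 0 < n%:R :> R by rewrite ltr0n (leq_trans _ n2).
have T0 : 0 < T by apply: lt_le_trans nT; exact: powR_gt0.
have V0 := weight_pow_ge0.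
have PV0 (k : {ffun J -> 'I_N.+1}) : 0 <= \prod_c V (k c) by exact: prodr_ge0.
pose S a i (k : {ffun J -> 'I_N.+1}) :=
  [forall c, (c != a) ==> ((k c < n) && (k c <= i))%N] &&
  (T * \prod_(c | c != a) h (k c) < i.+1%:R).
pose G a i (k : {ffun J -> 'I_N.+1}) : R :=
  if S a i k then V i * \prod_(c | c != a) V (k c) else 0.
pose E a c (k : {ffun J -> 'I_N.+1}) : R :=
  if (n <= k a)%N && (n <= k c)%N then \prod_x V (k x) else 0.
have G0 a i k : 0 <= G a i k.
  by rewrite /G; case: ifP => // _; rewrite mulr_ge0 ?prodr_ge0.
have E0 a c k : 0 <= E a c k by rewrite /E; case: ifP.
set M : R := ln n%:R `^ e * T `^ (1 - 2 * r).
have M0 : 0 <= M by rewrite mulr_ge0 ?powR_ge0.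
apply: (@le_trans _ _ (\sum_(k : {ffun J -> 'I_N.+1})
    (\sum_a G a (k a) k + \sum_a \sum_(c | a != c) E a c k))).
  rewrite big_mkcond; apply: ler_sum => k _.
  have SG0 : 0 <= \sum_a G a (k a) k by apply: sumr_ge0.
  have SE0 : 0 <= \sum_a \sum_(c | a != c) E a c k.
    by apply: sumr_ge0 => a _; apply: sumr_ge0.
  case: ifPn => [|_]; last by rewrite addr_ge0.
  move=> /forallPn[a]; rewrite negb_imply -ltNge => /andP[/forallP amax aT].
  have [small|] := boolP [forall c, (c != a) ==> (k c < n)%N].
    apply: (ler_wpDr SE0); apply: (@le_trans _ _ (G a (k a) k)); last first.
      by apply: (@sumr_ge_term _ _ xpredT (fun a => G a (k a) k)).
    rewrite /G /S aT andbT ifT ?[leLHS](bigD1 a)//.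
    apply/forallP => c; apply/implyP => ca.
    by rewrite amax andbT (implyP (forallP small c)).
  move=> /forallPn[c]; rewrite negb_imply -leqNgt => /andP[ca nc].
  apply: (ler_wpDl SG0); apply: (@le_trans _ _ (E a c k)).
    by rewrite /E nc (leq_trans nc (amax c)).
  apply: (@le_trans _ _ (\sum_(c | a != c) E a c k)).
    by apply: (@sumr_ge_term _ _ _ (fun c => E a c k)); rewrite // eq_sym.
  apply: (@sumr_ge_term _ _ xpredT (fun a => \sum_(c | a != c) E a c k)) => // x _.
  exact: sumr_ge0.
rewrite big_split /=.
apply: (@le_trans _ _ (b * C * (M * (\sum_(i < n) h i) ^+ #|J|.-1) +
    b * (b * D ^+ #|J|) * n%:R `^ (- (3 * eta)))); last first.
  have bC0 : 0 <= b * C by rewrite mulr_ge0 ?(ltW b0) ?(ltW C0).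
  have bD0 : 0 <= b * (b * D ^+ #|J|) by rewrite !mulr_ge0 ?(ltW b0) ?(ltW DJ0).
  rewrite [leRHS]mulrDr; apply: lerD.
    rewrite ler_wpM2r ?lerDl// mulr_ge0// exprn_ge0// sumr_ge0// => i _.
    by rewrite ltW ?log_weight_gt0.
  by rewrite ler_wpM2r ?powR_ge0// lerDr.
apply: lerD.
  rewrite exchange_big /=.
  apply: (@le_trans _ _ (\sum_(a : J) (C * M) * (\sum_(i < n) h i) ^+ #|J|.-1)).
    apply: ler_sum => a _.
    have CM0 : 0 <= C * M by rewrite mulr_ge0// ltW.
    pose f i := if (i < n)%N then h i else 0.
    have f0 i : 0 <= f i by rewrite /f; case: ifP => // _; rewrite ltW ?log_weight_gt0.
    apply: (@le_trans _ _ (C * M * (\sum_(i < N.+1) f i) ^+ #|J|.-1)); last first.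
      rewrite ler_wpM2l// lerXn2r ?nnegrE ?sumr_ge0//.
        by move=> i _; rewrite ltW ?log_weight_gt0.
      rewrite -(big_mkord xpredT f) -(big_mkord xpredT h) /f.
      rewrite -big_mkcond /= [leRHS]big_mkcond /=.
      have hh0 i : 0 <= h i by rewrite ltW ?log_weight_gt0.
      have [nN|Nn] := leqP N.+1 n.
        rewrite [leRHS](big_cat_nat (leq0n N.+1) nN) /= -[leLHS]addr0 lerD ?sumr_ge0//.
        by rewrite big_mkcond; apply: ler_sum => i _; case: ifP.
      rewrite (big_cat_nat (leq0n n) (ltnW Nn)) /= [X in _ + X]big_nat_cond.
      rewrite [X in _ + X]big_pred0 ?addr0; last first.
        by move=> i; rewrite leqNgt; case: (i < n)%N; rewrite ?andbF.
      by rewrite big_mkcond; apply: ler_sum => i _; case: ifP.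
    apply: sum_ffun_coord => [i k j|k].
      have upd c : c != a -> set_coord k a j c = k c.
        by move=> /negPf ca; rewrite ffunE ca.
      have pe (F : nat -> R) : \prod_(c | c != a) F (set_coord k a j c) = \prod_(c | c != a) F (k c).
        by apply: eq_bigr => c ca; rewrite upd.
      have SE : S a i (set_coord k a j) = S a i k.
        rewrite /S (pe h); congr (_ && _).
        by apply: eq_forallb => c; case: eqP => //= /eqP ca; rewrite upd.
      rewrite /G SE; case: (S a i k); last reflexivity.
      apply: (congr1 (fun z => V i * z)); apply: eq_bigr => c ca.
      rewrite (upd c ca); reflexivity.
    have [small|] := boolP [forall c, (c != a) ==> (k c < n)%N]; last first.
      move=> /forallPn[c]; rewrite negb_imply -leqNgt => /andP[ca nc].
      have pf0 : 0 <= \prod_(c0 | c0 != a) f (k c0) by apply: prodr_ge0.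
      rewrite big1 ?(mulr_ge0 CM0)// => i _; rewrite /G /S.
      have /negPf -> // : ~~ [forall c, (c != a) ==> ((k c < n) && (k c <= i))%N].
      by apply/forallPn; exists c; rewrite ca ltnNge nc.
    set Y := T * \prod_(c | c != a) h (k c).
    have ph0 : 0 < \prod_(c | c != a) h (k c).
      by apply: prodr_gt0 => c _; exact: log_weight_gt0.
    have Y0 : 0 < Y by rewrite mulr_gt0.
    have /andP[_ pH] := prod_weight_le (fun c => k c : nat) a H1 hH.
    have Yn : Y <= n%:R by apply: le_trans Tn; rewrite ler_wpM2l ?(ltW T0).
    pose Q i := [forall c, (c != a) ==> (k c <= i)%N].
    have QL i : Q i -> Y < i.+1%:R -> ln n%:R <= cL * L i.
      move=> /forallP Qi Yi; apply: (hcL J n T (fun c => k c) a) => // c ca.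
      exact: (implyP (Qi c)).
    have {}hC := hC n N.+1 Y Q n2 (ltac:(by rewrite Y0)) QL.
    set pv := \prod_(c | c != a) V (k c).
    have pv0 : 0 <= pv by apply: prodr_ge0.
    apply: (@le_trans _ _ (pv * \sum_(i < N.+1 | Q i && (Y < i.+1%:R)) V i)).
      rewrite mulr_sumr [leRHS]big_mkcond; apply: ler_sum => i _.
      rewrite /G; case: ifPn => [/andP[/forallP Si Yi]|_].
        rewrite mulrC Yi andbT ifT//.
        by apply/forallP => c; apply/implyP => /(implyP (Si c))/andP[].
      by case: ifP => // _; rewrite mulr_ge0.
    apply: (le_trans (ler_wpM2l pv0 hC)).
    rewrite /Y powRM ?(ltW T0) ?(ltW ph0)// /M.
    have -> : \prod_(c | c != a) f (k c) = \prod_(c | c != a) h (k c).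
      by apply: eq_bigr => c ca; rewrite /f (implyP (forallP small c) ca).
    have -> : pv = (\prod_(c | c != a) h (k c)) `^ (2 * r).
      by rewrite powR_prod// => i; rewrite ltW ?log_weight_gt0.
    set p := \prod_(c | c != a) h (k c).
    rewrite le_eqVlt; apply/orP; left; apply/eqP.
    have : p `^ (2 * r) * p `^ (1 - 2 * r) = p.
      rewrite -powRD; last by rewrite (gt_eqF ph0) implybT.
      by rewrite addrC subrK powRr1 ?(ltW ph0).
    move: (p `^ (2 * r)) (p `^ (1 - 2 * r)) (ln n%:R `^ e) (T `^ (1 - 2 * r)) => u v x y <-.
    ring.
  by rewrite sumr_const -mulr_natl -/b !mulrA.
rewrite exchange_big /=.
apply: (@le_trans _ _ (\sum_(a : J) \sum_(c : J) D ^+ #|J| * n%:R `^ (- (3 * eta)))).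
  apply: ler_sum => a _; rewrite exchange_big /= big_mkcond; apply: ler_sum => c _.
  have B0 : 0 <= D ^+ #|J| * n%:R `^ (- (3 * eta)).
    by rewrite mulr_ge0 ?powR_ge0// ltW.
  case: ifPn => // ac; rewrite -big_mkcond.
  by apply: hD => //; exact: ltnW.
rewrite (eq_bigr (fun=> b * (D ^+ #|J| * n%:R `^ (- (3 * eta))))); last first.
  by move=> a _; rewrite sumr_const [RHS]mulr_natl.
by rewrite sumr_const -[leLHS]mulr_natl -/b !mulrA.
Qed.

End tail.
End weighted_cross.

(** * Derandomized Kaczmarz iteration *)
Section kaczmarz.
Context (d : measure_display) (S : measurableType d) (R : realType).
Context (nu : probability S R) (I : finType) (E : I -> S -> R).

Definition combination (x : I -> R) (t : S) : R := \sum_j x j * E j t.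
Definition sqnorm (x : I -> R) : R := \sum_j x j ^+ 2.
Local Notation s t := (\sum_j E j t ^+ 2).

(** Orthogonal projection of [x] onto the hyperplane of the vectors [z] such
    that [y + combination z t = 0]: the residual is made to vanish at [t],
    where only the sum of [y] and of [combination x t] can be observed. *)
Definition kaczmarz (x : I -> R) (y : R) (t : S) : I -> R :=
  fun j => x j - (y + combination x t) / s t * E j t.

Lemma sqnorm_ge0 x : 0 <= sqnorm x.
Proof. by apply: sumr_ge0 => j _; rewrite sqr_ge0. Qed.

(** Pythagoras; multiplying by [s t] keeps the identity polynomial in [E], so
    that it can be integrated. *)
Lemma sqnorm_kaczmarz x y t : 0 < s t ->
  s t * sqnorm (kaczmarz x y t) + combination x t ^+ 2 = s t * sqnorm x + y ^+ 2.
Proof.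
move=> s0; set c := (y + combination x t) / s t.
have -> : sqnorm (kaczmarz x y t) = sqnorm x - 2 * c * combination x t + c ^+ 2 * s t.
  rewrite /sqnorm /kaczmarz -/c /combination !mulr_sumr -sumrB -big_split /=.
  by apply: eq_bigr => j _; ring.
by rewrite /c; field; rewrite gt_eqF.
Qed.

Lemma combination_sqr_le x t : 0 < s t -> combination x t ^+ 2 <= s t * sqnorm x.
Proof.
move=> s0; have := sqnorm_kaczmarz x 0 s0; rewrite expr0n addr0 => <-.
by rewrite lerDr mulr_ge0 ?sqnorm_ge0 ?(ltW s0).
Qed.

Hypothesis mE : forall j, measurable_fun setT (E j).
Hypothesis intE : forall i j, nu.-integrable setT (fun t => (E i t * E j t)%:E).
Hypothesis orthE : forall i j,
  (\int[nu]_t (E i t * E j t)%:E = ((i == j)%:R)%:E)%E.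

Lemma measurable_combination x : measurable_fun setT (combination x).
Proof.
by apply: measurable_sum => j; apply: measurable_funM => //; exact: measurable_cst.
Qed.

Lemma integral_combination_sqr x :
  (\int[nu]_t (combination x t ^+ 2)%:E = (sqnorm x)%:E)%E.
Proof.
transitivity (\int[nu]_t (\sum_i \sum_j (x i * x j)%:E * (E i t * E j t)%:E))%E.
  apply: eq_integral => t _; rewrite /combination expr2 mulr_suml -sumEFin.
  apply: eq_bigr => i _; rewrite mulr_sumr -sumEFin; apply: eq_bigr => j _.
  by rewrite -EFinM; congr EFin; ring.
have intc i j : nu.-integrable setT (fun t => (x i * x j)%:E * (E i t * E j t)%:E)%E.
  by apply: integrableZl.
rewrite integral_sum//=; last by move=> i; apply: integrable_sum.
rewrite /sqnorm -sumEFin; apply: eq_bigr => i _.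
rewrite integral_sum//= (bigD1 i)//= big1 ?adde0 => [|j ji].
  by rewrite integralZl// orthE eqxx mule1 -expr2.
by rewrite integralZl// orthE eq_sym (negPf ji) mule0.
Qed.

Lemma integral_sum_sqr : (\int[nu]_t (s t)%:E = #|I|%:R%:E)%E.
Proof.
transitivity (\int[nu]_t (\sum_j (E j t * E j t)%:E))%E.
  by apply: eq_integral => t _; rewrite -sumEFin; apply: eq_bigr.
rewrite integral_sum//= (eq_bigr (fun=> 1%E)) => [|j _]; last by rewrite orthE eqxx.
by rewrite sumEFin -sum1_card natr_sum.
Qed.

Lemma exists_lt_of_integral_lt (G : set S) (f g : S -> \bar R) :
  {ae nu, forall t, G t} ->
  measurable_fun setT f -> measurable_fun setT g ->
  (forall t, 0 <= f t)%E -> (forall t, 0 <= g t)%E ->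
  (\int[nu]_t f t < \int[nu]_t g t)%E ->
  exists2 t, G t & (f t < g t)%E.
Proof.
move=> aeG mf mg f0 g0; apply: contraPP => /forall2NP fg; apply/negP; rewrite -leNgt.
apply: ae_ge0_le_integral => //.
by apply: filterS aeG => t Gt _; case: (fg t) => // /negP; rewrite -leNgt.
Qed.

(** Sum the identity [sqnorm_kaczmarz] over [n] and integrate: [s] has integral
    [#|I|], and the combinations have total squared norm [q <= Q].  If every
    point were worse than the claimed bound, integrating would give
    [D + q <= q + \int \sum_n (y n)^2], hence a contradiction. *)
Lemma exists_kaczmarz_node (G : set S) (y : nat -> S -> R) (x : nat -> I -> R)
    (D Q : R) :
  {ae nu, forall t, G t} -> (forall t, G t -> 0 < s t) ->
  (forall n, measurable_fun setT (y n)) ->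
  (\sum_(n <oo) \int[nu]_t (y n t ^+ 2)%:E < D%:E)%E ->
  (\sum_(n <oo) (sqnorm (x n))%:E <= Q%:E)%E ->
  exists2 t, G t & (\sum_(n <oo) (sqnorm (kaczmarz (x n) (y n t) t))%:E <=
    (Q * (1 - #|I|%:R^-1) + D / #|I|%:R)%:E)%E.
Proof.
move=> aeG Gs my hD hQ.
have [t0 Gt0] : exists t, G t.
  have [t Gt _] := @exists_lt_of_integral_lt G (cst 0%E) (cst 1%E) aeG
    (measurable_cst _) (measurable_cst _) (fun=> lexx _) (fun=> lee01)
    (ltac:(by rewrite !integral_cst//= probability_setT mul0e mul1e lte01)).
  by exists t.
have M0 : 0 < #|I|%:R :> R.
  rewrite ltr0n lt0n; apply/eqP => I0; have := Gs _ Gt0.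
  by rewrite big1 ?ltxx// => j _; have := card0_eq I0 j; rewrite inE.
set M : R := #|I|%:R.
set Qx := (\sum_(n <oo) (sqnorm (x n))%:E)%E.
have Qx0 : (0 <= Qx)%E by apply: nneseries_ge0 => n _ _; rewrite lee_fin sqnorm_ge0.
have /fineK QxE : Qx \is a fin_num.
  by rewrite ge0_fin_numE// (le_lt_trans hQ)// ltry.
set q := fine Qx.
have q0 : 0 <= q by exact: fine_ge0.
pose a t := (\sum_(n <oo) (y n t ^+ 2)%:E)%E.
pose b t := (\sum_(n <oo) (combination (x n) t ^+ 2)%:E)%E.
have a0 t : (0 <= a t)%E by apply: nneseries_ge0 => n _ _; rewrite lee_fin sqr_ge0.
have b0 t : (0 <= b t)%E by apply: nneseries_ge0 => n _ _; rewrite lee_fin sqr_ge0.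
have s0 t : 0 <= s t by apply: sumr_ge0 => j _; rewrite sqr_ge0.
have msqr (f : S -> R) : measurable_fun setT f -> measurable_fun setT (fun t => (f t ^+ 2)%:E).
  by move=> mf; apply/measurable_EFinP; exact: measurable_funX.
have ma : measurable_fun setT a.
  by apply: ge0_emeasurable_sum => [n t _ _|n _]; [rewrite lee_fin sqr_ge0|exact: msqr].
have mb : measurable_fun setT b.
  apply: ge0_emeasurable_sum => [n t _ _|n _]; first by rewrite lee_fin sqr_ge0.
  by apply: msqr; exact: measurable_combination.
have ms : measurable_fun setT (fun t => (s t)%:E).
  apply/measurable_EFinP; apply: measurable_sum => j; exact: measurable_funX.
have inta : (\int[nu]_t a t = \sum_(n <oo) \int[nu]_t (y n t ^+ 2)%:E)%E.
  rewrite integral_nneseries// => [n|n t _]; first exact: msqr.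
  by rewrite lee_fin sqr_ge0.
have intb : (\int[nu]_t b t = q%:E)%E.
  rewrite integral_nneseries// => [|n|n t _].
  - by rewrite QxE /Qx; apply: eq_eseriesr => n _; rewrite integral_combination_sqr.
  - by apply: msqr; exact: measurable_combination.
  - by rewrite lee_fin sqr_ge0.
have D0 : 0 < D.
  rewrite -lte_fin; apply: le_lt_trans hD; rewrite -inta.
  by apply: integral_ge0.
pose f t := (a t + (q / M)%:E * (s t)%:E)%E.
pose g t := (b t + (D / M)%:E * (s t)%:E)%E.
have intMs (c : R) (h : S -> \bar R) : 0 <= c -> measurable_fun setT h -> (forall t, 0 <= h t)%E ->
    (\int[nu]_t (h t + (c / M)%:E * (s t)%:E) = \int[nu]_t h t + c%:E)%E.
  move=> c0 mh h0; have cM0 : 0 <= c / M by rewrite divr_ge0// ltW.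
  rewrite ge0_integralD//; last 2 first.
    by move=> t _; rewrite mule_ge0 ?lee_fin.
    by apply: measurable_funeM.
  rewrite ge0_integralZl_EFin//; last by move=> t _; rewrite lee_fin.
  by rewrite integral_sum_sqr -EFinM divfK// gt_eqF.
(* [f t < g t] is the desired bound, cleared of subtractions: every term is
   nonnegative and may be infinite before the point is known *)
have [t Gt fgt] : exists2 t, G t & (f t < g t)%E.
  apply: exists_lt_of_integral_lt => //.
  - by apply: emeasurable_funD => //; apply: measurable_funeM.
  - by apply: emeasurable_funD => //; apply: measurable_funeM.
  - by move=> t; rewrite adde_ge0 ?mule_ge0 ?lee_fin ?divr_ge0 ?(ltW M0).
  - by move=> t; rewrite adde_ge0 ?mule_ge0 ?lee_fin ?divr_ge0 ?(ltW M0) ?(ltW D0).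
  - by rewrite !intMs ?(ltW D0)// inta intb addeC lteD2lE.
exists t => //; have st0 := Gs t Gt.
set Z := (\sum_(n <oo) _)%E.
have Z0 : (0 <= Z)%E by apply: nneseries_ge0 => n _ _; rewrite lee_fin sqnorm_ge0.
have key : ((s t)%:E * Z + b t = (s t * q)%:E + a t)%E.
  rewrite EFinM QxE -!nneseriesZl ?(ltW st0)//; try by move=> n _; rewrite lee_fin sqnorm_ge0.
  rewrite -!nneseriesD; try by move=> n _ _; rewrite ?mule_ge0 ?lee_fin ?sqr_ge0 ?sqnorm_ge0.
  apply: eq_eseriesr => n _; rewrite -!EFinM -!EFinD; congr EFin.
  exact: sqnorm_kaczmarz.
have bfin : b t \is a fin_num.
  rewrite ge0_fin_numE// (@le_lt_trans _ _ (s t * q)%:E)// ?ltry//.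
  rewrite EFinM QxE -nneseriesZl; last by move=> n _; rewrite lee_fin sqnorm_ge0.
  apply: lee_nneseries => [n _ _|n _]; first by rewrite lee_fin sqr_ge0.
  by rewrite -EFinM lee_fin combination_sqr_le.
move: key fgt; rewrite /f /g -(fineK bfin); set bt := fine (b t).
case: (a t) (a0 t) => [at_ _|_|//]; last first.
  by rewrite addye.
rewrite -EFinM -!EFinD.
case: Z Z0 => [z _|_|//]; last by rewrite gt0_muley ?lte_fin.
rewrite -EFinM -EFinD => -[key]; rewrite lte_fin => lt.
rewrite lee_fin.
apply: (@le_trans _ _ (q * (1 - M^-1) + D / M)).
  rewrite -(ler_pM2l st0); move: key lt.
  have -> : s t * (q * (1 - M^-1) + D / M) = s t * q - q / M * s t + D / M * s t by ring.
  lra.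
rewrite lerD2r ler_wpM2r// ?subr_ge0 ?invf_le1 ?ler1n// .
  by rewrite -(ltr0n R).
by rewrite -lee_fin QxE.
Qed.

(** A linear algorithm with values in the span of [E], as a list of nodes and
    of coefficient vectors of the functions that multiply the point values. *)
Definition sampling (sm : seq (S * (I -> R))) (f : S -> R) : I -> R :=
  fun j => \sum_(p <- sm) f p.1 * p.2 j.

(** [D] is the fixed point of [Q |-> Q * (1 - M^-1) + D * M^-1], so iterating
    the choice of a node leaves [D] plus a geometric term.  A new node is used
    on the residual of the previous algorithm, which is itself a linear
    function of the point values; this is why the old coefficient vectors are
    modified as well. *)
Lemma exists_sampling (G : set S) (c y : nat -> S -> R) (x : nat -> I -> R)
    (D W : R) :
  {ae nu, forall t, G t} -> (forall t, G t -> 0 < s t) ->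
  (forall n, measurable_fun setT (y n)) ->
  (forall n t, G t -> c n t = y n t + combination (x n) t) ->
  (\sum_(n <oo) \int[nu]_t (y n t ^+ 2)%:E < D%:E)%E ->
  (\sum_(n <oo) (sqnorm (x n))%:E <= W%:E)%E ->
  forall L, exists sm : seq (S * (I -> R)), [/\ size sm = L,
    (forall p, p \in [seq p.1 | p <- sm] -> G p) &
    (\sum_(n <oo) (sqnorm (fun j => x n j - sampling sm (c n) j))%:E <=
      (W * (1 - #|I|%:R^-1) ^+ L + D)%:E)%E].
Proof.
move=> aeG Gs my hc hD hW; elim=> [|L [sm [sL smG smW]]].
  exists [::]; split => //.
  apply: (@le_trans _ _ W%:E); last first.
    rewrite lee_fin expr0 mulr1 lerDl -lee_fin; apply: le_trans (ltW hD).
    by apply: nneseries_ge0 => n _ _; apply: integral_ge0 => t _; rewrite lee_fin sqr_ge0.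
  apply: le_trans hW; apply: lee_nneseries => [n _ _|n _].
    by rewrite lee_fin sqnorm_ge0.
  rewrite lee_fin /sqnorm; apply: ler_sum => j _.
  by rewrite /sampling big_nil subr0.
have [t Gt ht] := exists_kaczmarz_node aeG Gs my hD smW.
exists ((t, fun j => E j t / s t) ::
  [seq (p.1, fun j => p.2 j - combination p.2 t / s t * E j t) | p <- sm]).
split.
- by rewrite /= size_map sL.
- move=> p; rewrite /= inE => /predU1P[->//|]; rewrite -map_comp.
  exact: smG.
apply: le_trans (le_trans ht _); last first.
  rewrite lee_fin le_eqVlt; apply/orP; left; apply/eqP; rewrite exprSr; ring.
rewrite le_eqVlt; apply/orP; left; apply/eqP; apply: eq_eseriesr => n _.
congr EFin; apply: eq_bigr => j _; congr (_ ^+ 2).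
have -> : y n t = c n t - combination (x n) t by rewrite hc// addrK.
have combS : combination (fun j => x n j - sampling sm (c n) j) t =
    combination (x n) t - \sum_(p <- sm) c n p.1 * combination p.2 t.
  rewrite /combination -(eq_bigr _ (fun p _ => esym (mulr_sumr _ _ _ _))) exchange_big /=.
  rewrite -sumrB; apply: eq_bigr => i _; rewrite mulrBl /sampling mulr_suml.
  by congr (_ - _); apply: eq_bigr => p _; rewrite mulrA.
rewrite /kaczmarz combS /sampling big_cons big_map /=.
have -> : \sum_(p <- sm) c n p.1 * (p.2 j - combination p.2 t / s t * E j t) =
    \sum_(p <- sm) c n p.1 * p.2 j -
    (\sum_(p <- sm) c n p.1 * combination p.2 t) / s t * E j t.
  by rewrite !mulr_suml -sumrB; apply: eq_bigr => p _; ring.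
set A := \sum_(p <- sm) _; set B := \sum_(p <- sm) _; set z := combination (x n) t.
move: (s t) => st; ring.
Qed.

End kaczmarz.

(** * Square-integrable functions and tensor products *)
Section L2.
Context (disp : measure_display) (T : measurableType disp) (R : realType).
Context (mu : {measure set T -> \bar R}).

Lemma abse_powR2 (x : R) : (`|x%:E| `^ 2 = (x ^+ 2)%:E)%E.
Proof. by rewrite abse_EFin poweR_EFin powR_mulrn// real_normK// num_real. Qed.

Lemma L2_norm_sqr (f : T -> R) :
  ((L2_norm mu f) ^+ 2 = \int[mu]_x (f x ^+ 2)%:E)%E.
Proof.
rewrite -[RHS](_ : \int[mu]_x (`|(EFin \o f) x| `^ 2) = _)%E; last first.
  by apply: eq_integral => x _; exact: abse_powR2.
rewrite -poweR_Lnorm// /L2_norm.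
have := Lnorm_ge0 mu 2%:E (EFin \o f).
case: ('N[mu]_2%:E[EFin \o f])%E => [x x0|_|//].
  by rewrite poweR_EFin powR_mulrn// -lee_fin.
by rewrite poweRyr.
Qed.

Lemma Lfun2P (f : T -> R) : measurable_fun setT f ->
  (\int[mu]_x (f x ^+ 2)%:E < +oo)%E -> f \in Lfun mu 2%:E.
Proof.
move=> mf ltf; rewrite inE; apply/andP; split; rewrite inE//=.
rewrite /finite_norm unlock; apply: poweR_lty.
rewrite (eq_integral (fun x => (f x ^+ 2)%:E))// => x _.
exact: abse_powR2.
Qed.

Lemma Lfun2_measurable (f : T -> R) : f \in Lfun mu 2%:E -> measurable_fun setT f.
Proof. by rewrite inE => /andP[]; rewrite inE. Qed.

Lemma Lfun2_integrableM (f g : T -> R) :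
  f \in Lfun mu 2%:E -> g \in Lfun mu 2%:E ->
  mu.-integrable setT (fun x => (f x * g x)%:E).
Proof. by move=> Lf Lg; apply/Lfun1_integrable; exact: Lfun2_mul_Lfun1. Qed.

End L2.

Section product_integral.
Context (d1 d2 : measure_display) (T1 : measurableType d1) (T2 : measurableType d2).
Context (R : realType) (m1 : probability T1 R) (m2 : probability T2 R).

Lemma integral_prod_mul (f : T1 -> R) (g : T2 -> R) :
  m1.-integrable setT (EFin \o f) -> m2.-integrable setT (EFin \o g) ->
  (m1 \x m2)%E.-integrable setT (fun z => (f z.1 * g z.2)%:E) /\
  (\int[m1 \x m2]_z (f z.1 * g z.2)%:E =
     \int[m1]_x (f x)%:E * \int[m2]_y (g y)%:E)%E.
Proof.
move=> intf intg.
have mf : measurable_fun setT f by apply/measurable_EFinP; exact: measurable_int intf.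
have mg : measurable_fun setT g by apply/measurable_EFinP; exact: measurable_int intg.
have mfg : measurable_fun setT (fun z : T1 * T2 => (f z.1 * g z.2)%:E).
  by apply/measurable_EFinP; apply: measurable_funM; exact: measurableT_comp.
have intg_fin : (\int[m2]_y (g y)%:E)%E \is a fin_num by exact: integrable_fin_num.
have intfg : (m1 \x m2)%E.-integrable setT (fun z => (f z.1 * g z.2)%:E).
  apply/integrable12ltyP => //.
  have -> : (fun x => \int[m2]_y `|(f (x, y).1 * g (x, y).2)%:E|)%E =
      (fun x => `|(f x)%:E| * \int[m2]_y `|(g y)%:E|)%E.
    apply/funext => x; rewrite -ge0_integralZl//.
      by apply: eq_integral => y _; rewrite /= normrM EFinM.
    by apply: measurableT_comp => //; exact/measurable_EFinP.
  have := integrableP _ _ _ intf => -[_ lf]; have := integrableP _ _ _ intg => -[_ lg].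
  rewrite ge0_integralZr//.
  - by apply: lte_mul_pinfty => //; [exact: integral_ge0|rewrite ge0_fin_numE//; exact: integral_ge0].
  - by apply: measurableT_comp => //; exact/measurable_EFinP.
  - exact: integral_ge0.
split => //; rewrite -integral12_prod_meas1//.
rewrite /fubini_F /=.
have -> : (fun x => \int[m2]_y (f x * g y)%:E)%E =
   (fun x => (f x)%:E * \int[m2]_y (g y)%:E)%E.
  by apply/funext => x; rewrite -integralZl.
rewrite -(fineK intg_fin) integralZr//.
Qed.

End product_integral.

Section tensor_product.
Context (R : realType).

Lemma integral_cube_prod (d : nat) (f : 'I_d -> R -> R) :
  (forall a, (@unit_lebesgue R).-integrable setT (EFin \o f a)) ->
  (cube_lebesgue R d).-integrable setT (fun t => (\prod_a f a (tnth t a))%:E) /\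
  (\int[cube_lebesgue R d]_t (\prod_a f a (tnth t a))%:E =
     (\prod_a \int[@unit_lebesgue R]_x (f a x))%:E)%E.
Proof.
elim: d f => [|d IH] f intf.
  have -> : (fun t : 0.-tuple R => (\prod_a f a (tnth t a))%:E) = cst 1%E.
    by apply/funext => t; rewrite big_ord0.
  rewrite big_ord0 integral_cst//= ; split=> //.
    exact: finite_measure_integrable_cst.
  by rewrite mul1e diracT.
have [intg Ig] := IH (fun a => f (lift ord0 a)) (fun a => intf (lift ord0 a)).
have [intfg Ifg] := integral_prod_mul (intf ord0) intg.
have mf a : measurable_fun setT (f a).
  by apply/measurable_EFinP; exact: measurable_int (intf a).
have mF : measurable_fun setT (fun t : d.+1.-tuple R => (\prod_a f a (tnth t a))%:E).
  apply/measurable_EFinP; apply: measurable_prod => a _.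
  by apply: measurableT_comp => //; exact: measurable_tnth.
have FE : (fun t : d.+1.-tuple R => (\prod_a f a (tnth t a))%:E) \o @tuple_cons R d =
    (fun z => (f ord0 z.1 * \prod_a f (lift ord0 a) (tnth z.2 a))%:E).
  apply/funext => -[x t] /=; rewrite big_ord_recl /=; congr (_ * _)%:E.
  by apply: eq_bigr => a _; rewrite tnthS.
split.
  apply/integrableP; split => //=.
  rewrite ge0_integral_distribution//=.
    have /integrableP[_] := intfg; apply: le_lt_trans.
    rewrite le_eqVlt; apply/orP; left; apply/eqP; apply: eq_integral => z _.
    exact: (congr1 (fun h => `|h z|%E) FE).
  exact: (measurableT_comp (@abse_measurable R setT) mF).
rewrite [LHS]integral_distribution ?FE//.
rewrite [LHS]Ifg Ig big_ord_recl [RHS]EFinM; congr (_ * _)%E.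
by rewrite /Rintegral fineK//; exact: (integrable_fin_num _ (intf ord0)).
Qed.

Definition tensor (phi : nat -> R -> R) (d : nat) (k : 'I_d -> nat)
  (t : d.-tuple R) : R := \prod_a phi (k a) (tnth t a).

Variable phi : nat -> R -> R.
Hypothesis hphi : orthonormal_basis (@unit_lebesgue R) phi.

Let L2phi i : phi i \in Lfun (@unit_lebesgue R) 2%:E.
Proof. by case: hphi. Qed.

Lemma measurable_tensor d (k : 'I_d -> nat) : measurable_fun setT (tensor phi k).
Proof.
apply: measurable_prod => a _; apply: measurableT_comp; last exact: measurable_tnth.
exact: Lfun2_measurable (L2phi _).
Qed.

Lemma tensor_orthonormal d (k l : 'I_d -> nat) :
  (cube_lebesgue R d).-integrable setT (fun t => (tensor phi k t * tensor phi l t)%:E) /\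
  (\int[cube_lebesgue R d]_t (tensor phi k t * tensor phi l t)%:E =
     ([forall a, k a == l a]%:R)%:E)%E.
Proof.
have [] := @integral_cube_prod d (fun a x => phi (k a) x * phi (l a) x).
  by move=> a; exact: Lfun2_integrableM.
under eq_fun do rewrite big_split /=.
move=> intkl Ikl; split => //; rewrite [LHS]Ikl; congr EFin.
under eq_bigr do (have [_ -> _] := hphi).
have [/forallP kl|/forallPn[a /negPf kla]] := boolP [forall a, k a == l a].
  by rewrite big1// => a _; rewrite kl.
by rewrite (bigD1 a)//= kla mul0r.
Qed.

Lemma ae_unit_cube d : {ae cube_lebesgue R d, forall t, unit_cube t}.
Proof.
pose B := fun a : 'I_d => (`[0%R, 1%R]%classic : set R).
have mB : measurable [set t : d.-tuple R | forall a, B a (tnth t a)].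
  have -> : [set t : d.-tuple R | forall a, B a (tnth t a)] =
      \bigcap_(a in [set: 'I_d]) ((@tnth _ R ^~ a) @^-1` B a).
    by apply/seteqP; split => [t H a _|t H a]; [exact: H|exact: (H a I)].
  apply: fin_bigcap_measurable => // a _; rewrite -[X in measurable X]setTI.
  by apply: measurable_tnth => //; exact: measurable_itv.
exists (~` [set t : d.-tuple R | forall a, B a (tnth t a)]); split.
- exact: measurableC.
- rewrite probability_setC// cube_lebesgue_box; last by move=> a; exact: measurable_itv.
  rewrite big1 ?subee// => a _; rewrite setIid.
  by rewrite lebesgue_measure_itv /= lte_fin ltr01 oppr0 adde0.
- by apply: subsetC => t Ht a; exact: Ht.
Qed.

End tensor_product.

(** * From the random field to its coefficients *)
#[local] Existing Instance totally_filter.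

(** Sums over a countable type of indices are written as series of extended
    reals along an enumeration; a number that encodes no index contributes 0. *)
Section nneseries_enumeration.
Context (R : realType) (I : choiceType) (code : I -> nat) (decode : nat -> option I).
Hypothesis codeK : pcancel code decode.

Lemma sum_fset_le_nneseries (F : {fset I}) (a : I -> R) :
  (forall i, 0 <= a i) ->
  ((\sum_(i <- F) a i)%:E <= \sum_(n <oo) (oapp a 0 (decode n))%:E)%E.
Proof.
move=> a0; pose u n := oapp a 0 (decode n).
have u0 n : 0 <= u n by rewrite /u; case: decode => [i|]//=.
pose N := (\max_(i <- F) code i).+1.
apply: le_trans (@nneseries_lim_ge R (EFin \o u) xpredT 0 N _); last first.
  by move=> n _ _; rewrite lee_fin.
rewrite /= sumEFin lee_fin.
rewrite (eq_bigr (fun i => u (code i))) => [|i _]; last by rewrite /u codeK.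
rewrite -(big_map code xpredT u).
have uF : uniq [seq code i | i <- F].
  by rewrite map_inj_uniq ?fset_uniq//; exact: pcan_inj codeK.
rewrite -(perm_big _ (uniq_perm (filter_uniq (mem [seq code i | i <- F]) (iota_uniq 0 N)) uF _)).
  rewrite big_filter big_mkcond /= /index_iota subn0.
  by apply: ler_sum => n _; case: ifP.
move=> n; rewrite mem_filter mem_iota andb_idr// add0n => /mapP[i iF ->].
by rewrite /N ltnS; exact: leq_bigmax_seq.
Qed.

End nneseries_enumeration.

Section second_moment.
Context (disp : measure_display) (T : measurableType disp) (R : realType).
Context (P : probability T R) (I : choiceType) (xi : I -> {RV P >-> R}).
Hypothesis hxi : standard_noncorrelated xi.

Lemma integral_noncorrelated i j :
  P.-integrable setT (fun w => (xi i w * xi j w)%:E) /\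
  (\int[P]_w (xi i w * xi j w)%:E = ((i == j)%:R)%:E)%E.
Proof.
have [E0 V1 cov0] := hxi.
have covE k l : covariance P (xi k) (xi l) = (\int[P]_w (xi k w * xi l w)%:E)%E.
  rewrite unlock !E0 unlock /=; apply: eq_integral => w _.
  by rewrite !fctE /= !subr0.
have L2 k : (xi k : T -> R) \in Lfun P 2%:E.
  apply: Lfun2P => //; under eq_integral do rewrite expr2.
  by rewrite -covE [X in (X < _)%E]V1 ltry.
split; first exact: Lfun2_integrableM.
rewrite -covE; case: eqVneq => [->|ij]; last exact: cov0.
exact: V1.
Qed.

(** Noncorrelated standard variables are orthonormal functions on the
    probability space. *)
Lemma integral_sum_noncorrelated_sqr (F : {fset I}) (a : I -> R) :
  (\int[P]_w ((\sum_(i <- F) a i * xi i w) ^+ 2)%:E = (\sum_(i <- F) a i ^+ 2)%:E)%E.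
Proof.
have := @integral_combination_sqr _ T R P F (fun i => xi (val i)).
move=> /(_ _ _ (fun i => a (val i))) => H.
rewrite (big_seq_fsetE _ F xpredT (fun i => a i ^+ 2)) /=.
have := H (fun i j => (integral_noncorrelated _ _).1).
rewrite /sqnorm /combination => <-; last first.
  by move=> i j; have [_ ->] := integral_noncorrelated (val i) (val j).
by apply: eq_integral => w _; rewrite big_seq_fsetE.
Qed.

(** Cauchy-Schwarz, as the case of constant functions. *)
Lemma sqr_sumr_le m (v : 'I_m -> R) : (\sum_l v l) ^+ 2 <= m%:R * \sum_l v l ^+ 2.
Proof.
case: m v => [|m] v; first by rewrite !big_ord0 expr0n mulr0.
have := @combination_sqr_le _ T R 'I_m.+1 (fun _ => cst 1) v point.
rewrite /combination /sqnorm /=.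
under eq_bigr do rewrite expr1n.
rewrite sumr_const card_ord ltr0n => /(_ isT).
by under eq_bigr do rewrite mulr1.
Qed.

(** The series are compared with their partial sums over one finite set [F],
    close enough for [Y] and for all [Z l] at once.  Splitting off the partial
    sums by [(u + v)^2 <= 2 u^2 + 2 v^2] is where the factor 2 comes from. *)
Lemma second_moment_le (m : nat) (Y : T -> R) (Z : 'I_m -> T -> R)
    (cY : I -> R) (cZ : 'I_m -> I -> R) (v : 'I_m -> R) (U : \bar R) :
  measurable_fun setT Y -> (forall l, measurable_fun setT (Z l)) ->
  mean_square_sum P cY xi Y -> (forall l, mean_square_sum P (cZ l) xi (Z l)) ->
  (forall F : {fset I},
     (\sum_(i <- F) (cY i - \sum_l cZ l i * v l) ^+ 2)%:E <= U)%E ->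
  (\int[P]_w ((Y w - \sum_l Z l w * v l) ^+ 2)%:E <= 2%:E * U)%E.
Proof.
move=> mY mZ sY sZ hU.
pose SF c (F : {fset I}) w := \sum_(i <- F) c i * xi i w.
have mSF c F : measurable_fun setT (SF c F).
  apply: measurable_sum => i; apply: measurable_funM => //; exact: measurable_cst.
pose K := 4 * (1 + m%:R * \sum_l v l ^+ 2).
have V0 : 0 <= \sum_l v l ^+ 2 by apply: sumr_ge0 => l _; rewrite sqr_ge0.
have mV0 : 0 <= m%:R * \sum_l v l ^+ 2 by rewrite mulr_ge0.
have K0 : 0 < K by rewrite mulr_gt0// ltr_wpDr.
apply/lee_addgt0Pr => e e0.
pose e' := e / K; have e'0 : 0 < e' by rewrite divr_gt0.
have small (c : I -> R) (W : T -> R) : mean_square_sum P c xi W ->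
    \forall F \near totally, (\int[P]_w ((W w - SF c F w) ^+ 2)%:E <= e'%:E)%E.
  move=> hW; have := hW; rewrite /mean_square_sum unlock => /(_ [set x | (x < e'%:E)%E]).
  have no : nbhs (0%E : \bar R) [set x | (x < e'%:E)%E].
    by apply: open_nbhs_nbhs; split; [exact: open_ereal_lt_ereal|rewrite /= lte_fin].
  move=> /(_ no) h.
  have sub : [set F : {fset I} | (\int[P]_w ((W w - SF c F w) ^+ 2)%:E < e'%:E)%E]
      `<=` [set F | (\int[P]_w ((W w - SF c F w) ^+ 2)%:E <= e'%:E)%E].
    by move=> F /= /ltW.
  exact: (@filterS _ totally _ _ _ sub h).
have [F [FY FZ]] : exists F : {fset I},
    (\int[P]_w ((Y w - SF cY F w) ^+ 2)%:E <= e'%:E)%E /\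
    forall l, (\int[P]_w ((Z l w - SF (cZ l) F w) ^+ 2)%:E <= e'%:E)%E.
  have H1 := small _ _ sY.
  have H2 : \forall F \near totally, forall l,
      (\int[P]_w ((Z l w - SF (cZ l) F w) ^+ 2)%:E <= e'%:E)%E.
    by apply: filter_forall => l; exact: small.
  exact: (@filter_ex _ totally _ _ (filterI H1 H2)).
pose a i := cY i - \sum_l cZ l i * v l.
have SFa w : SF a F w = SF cY F w - \sum_l SF (cZ l) F w * v l.
  rewrite /SF /a; under [X in _ = _ - X]eq_bigr do rewrite mulr_suml.
  rewrite exchange_big /= -sumrB; apply: eq_bigr => i _.
  by rewrite mulrBl mulr_suml; congr (_ - _); apply: eq_bigr => l _; ring.
have ptw w : (Y w - \sum_l Z l w * v l) ^+ 2 <=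
    2 * SF a F w ^+ 2 + (4 * (Y w - SF cY F w) ^+ 2 +
      \sum_l 4 * m%:R * v l ^+ 2 * (Z l w - SF (cZ l) F w) ^+ 2).
  set A := SF a F w; set B := Y w - SF cY F w.
  set Cc := \sum_l (Z l w - SF (cZ l) F w) * v l.
  have -> : Y w - \sum_l Z l w * v l = A + (B - Cc).
    rewrite /A SFa /B /Cc; under [X in _ = _ + (_ - X)]eq_bigr do rewrite mulrBl.
    by rewrite sumrB; ring.
  have -> : \sum_l 4 * m%:R * v l ^+ 2 * (Z l w - SF (cZ l) F w) ^+ 2 =
      4 * (m%:R * \sum_l ((Z l w - SF (cZ l) F w) * v l) ^+ 2).
    by rewrite !mulr_sumr; apply: eq_bigr => l _; ring.
  have := sqr_sumr_le (fun l => (Z l w - SF (cZ l) F w) * v l); rewrite -/Cc.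
  set q := m%:R * _; have := sqr_ge0 (A - (B - Cc)); have := sqr_ge0 (B + Cc).
  by rewrite !expr2; lra.
have msqr (f : T -> R) : measurable_fun setT f -> measurable_fun setT (fun t => (f t ^+ 2)%:E).
  by move=> mf; apply/measurable_EFinP; exact: measurable_funX.
have mB : measurable_fun setT (fun w => Y w - SF cY F w) by exact: measurable_funB.
have mC l : measurable_fun setT (fun w => Z l w - SF (cZ l) F w) by exact: measurable_funB.
pose c4 l := 4 * m%:R * v l ^+ 2.
have c40 l : 0 <= c4 l by rewrite /c4 (mulr_ge0 _ (sqr_ge0 _))// mulr_ge0.
apply: (@le_trans _ _ (\int[P]_w (2%:E * (SF a F w ^+ 2)%:E + (4%:E * ((Y w - SF cY F w) ^+ 2)%:E +
      \sum_l (c4 l)%:E * ((Z l w - SF (cZ l) F w) ^+ 2)%:E)))%E).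
  apply: ge0_le_integral => //.
  - by move=> w _; rewrite lee_fin sqr_ge0.
  - apply: msqr; apply: measurable_funB => //; apply: measurable_sum => l.
    by apply: measurable_funM => //; exact: measurable_cst.
  - apply: emeasurable_funD; first by apply: measurable_funeM; exact: msqr.
    apply: emeasurable_funD; first by apply: measurable_funeM; exact: msqr.
    by apply: emeasurable_sum => l; apply: measurable_funeM; exact: msqr.
  - move=> w _; have := ptw w; rewrite -lee_fin => /le_trans; apply.
    by rewrite !EFinD -sumEFin !EFinM.
rewrite ge0_integralD//; last 4 first.
- by move=> w _; rewrite mule_ge0 ?lee_fin ?sqr_ge0.
- by apply: measurable_funeM; exact: msqr.
- move=> w _; rewrite !adde_ge0// ?mule_ge0 ?lee_fin ?sqr_ge0//.
  by apply: sume_ge0 => l _; rewrite mule_ge0 ?lee_fin ?sqr_ge0.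
- apply: emeasurable_funD; first by apply: measurable_funeM; exact: msqr.
  by apply: emeasurable_sum => l; apply: measurable_funeM; exact: msqr.
apply: leeD.
  rewrite ge0_integralZl_EFin//; last 2 first.
  - by move=> w _; rewrite lee_fin sqr_ge0.
  - exact: msqr.
  by apply: lee_wpmul2l; [rewrite lee_fin|rewrite integral_sum_noncorrelated_sqr; exact: hU].
rewrite ge0_integralD//; last 4 first.
- by move=> w _; rewrite mule_ge0 ?lee_fin ?sqr_ge0.
- by apply: measurable_funeM; exact: msqr.
- by move=> w _; apply: sume_ge0 => l _; rewrite mule_ge0 ?lee_fin ?sqr_ge0.
- by apply: emeasurable_sum => l; apply: measurable_funeM; exact: msqr.
rewrite ge0_integral_sum//; last 2 first.
- by move=> l; apply: measurable_funeM; exact: msqr.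
- by move=> l w _; rewrite mule_ge0 ?lee_fin ?sqr_ge0.
apply: (@le_trans _ _ (4%:E * e'%:E + \sum_l (c4 l)%:E * e'%:E)%E).
  apply: leeD.
    rewrite ge0_integralZl_EFin//; [|by move=> w _; rewrite lee_fin sqr_ge0|exact: msqr].
    by apply: lee_wpmul2l; rewrite ?lee_fin.
  apply: lee_sum => l _.
  rewrite ge0_integralZl_EFin//; [|by move=> w _; rewrite lee_fin sqr_ge0|exact: msqr].
  by apply: lee_wpmul2l; rewrite ?lee_fin.
rewrite -EFinM (eq_bigr (fun l => (c4 l * e')%:E)) => [|l _]; last by rewrite EFinM.
rewrite sumEFin -EFinD lee_fin -mulr_suml -mulrDl.
have -> : 4 + \sum_l c4 l = K.
  by rewrite /K mulrDr mulr1 !mulr_sumr; congr (_ + _); apply: eq_bigr => l _; rewrite /c4; ring.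
by rewrite /e' mulrC divfK// gt_eqF.
Qed.

End second_moment.

Section field.
Context (R : realType) (d b : nat) (phi : nat -> R -> R) (lambda : nat -> R).

(** The enumeration is passed to the estimates as a pair of functions, in order
    to leave [field_index d b] with its given choice structure. *)
Lemma field_index_enumeration : exists (code : field_index d b -> nat)
  (decode : nat -> option (field_index d b)),
  pcancel code decode /\ forall n i, decode n = Some i -> code i = n.
Proof.
pose CT : countType := {A : {A : {set 'I_d} | #|A| == b} &
  {ffun {a : 'I_d | a \in val A} -> nat}}.
exists (@choice.pickle CT); exists (@choice.pickle_inv CT).
split; first exact: pickleK_inv.
by move=> n i ni; have := @choice.pickle_invK CT n; rewrite ni.
Qed.

Hypothesis hphi : orthonormal_basis (@unit_lebesgue R) phi.

Lemma measurable_field_coef (i : field_index d b) :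
  measurable_fun setT (field_coef lambda phi i).
Proof.
case: i => A k; apply: measurable_funM; first exact: measurable_cst.
apply: measurable_prod => a _; apply: measurableT_comp; last exact: measurable_tnth.
by case: hphi => L2phi _ _; exact: Lfun2_measurable (L2phi _).
Qed.

Context (disp : measure_display) (T : measurableType disp) (P : probability T R).
Context (xi : field_index d b -> {RV P >-> R}) (X : T -> d.-tuple R -> R).
Hypothesis hxi : standard_noncorrelated xi.
Hypothesis hX : additive_random_field lambda phi xi X.

(** Fubini's theorem, and then the bound on second moments at almost every
    point [t].  The nodes have to be points where the series converges. *)
Lemma mean_square_error_le n (A : linear_algorithm R d n)
  (code : field_index d b -> nat) (decode : nat -> option (field_index d b)) :
  pcancel code decode ->
  (forall l, mean_square_sum P (field_coef lambda phi ^~ (node A l)) xi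
               (X ^~ (node A l))) ->
  (mean_square_error P X A <= 2%:E * \int[cube_lebesgue R d]_t
    \sum_(n <oo) (oapp (fun i => (field_coef lambda phi i t -
      Defs.approximation A (field_coef lambda phi i) t) ^+ 2) 0 (decode n))%:E)%E.
Proof.
move=> codeK hA; have [mX aeX] := hX.
pose Z w t := X w t - Defs.approximation A (X w) t.
have mw l : measurable_fun setT (weight A l) := Lfun2_measurable (weight_L2 A l).
have mXn l : measurable_fun setT (X ^~ (node A l)).
  exact: (measurable_fun_pair1 (node A l) mX).
have mXt t : measurable_fun setT (X ^~ t) by exact: (measurable_fun_pair1 t mX).
have mZ : measurable_fun setT (fun z => Z z.1 z.2).
  apply: measurable_funB => //; apply: measurable_sum => l.
  apply: measurable_funM.
    by apply: (measurableT_comp (mXn l)).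
  by apply: (measurableT_comp (mw l)).
pose f (z : T * d.-tuple R) := ((Z z.1 z.2) ^+ 2)%:E.
have mf : measurable_fun setT f by apply/measurable_EFinP; exact: measurable_funX.
pose u n t := oapp (fun i => (field_coef lambda phi i t -
      Defs.approximation A (field_coef lambda phi i) t) ^+ 2) 0 (decode n).
have u0 m t : 0 <= u m t by rewrite /u; case: (decode m) => //= i; rewrite sqr_ge0.
have mu m : measurable_fun setT (u m).
  rewrite /u; case: (decode m) => [i|] /=; last exact: measurable_cst.
  apply: measurable_funX; apply: measurable_funB; first exact: measurable_field_coef.
  by apply: measurable_sum => l; apply: measurable_funM => //; exact: measurable_cst.
have -> : mean_square_error P X A = (\int[P]_w \int[cube_lebesgue R d]_t f (w, t))%E.
  by apply: eq_integral => w _; rewrite L2_norm_sqr.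
rewrite fubini_tonelli//; last by move=> z; rewrite lee_fin sqr_ge0.
have ms : measurable_fun setT (fun t => \sum_(n <oo) (u n t)%:E)%E.
  apply: ge0_emeasurable_sum => [m t _ _|m _]; first by rewrite lee_fin.
  exact/measurable_EFinP.
have us0 t : (0 <= \sum_(n <oo) (u n t)%:E)%E.
  by apply: nneseries_ge0 => m _ _; rewrite lee_fin.
rewrite -(ge0_integralZl_EFin _ measurableT (fun t _ => us0 t) ms (ler0n R 2)).
apply: ae_ge0_le_integral => //.
- by move=> t _; apply: integral_ge0 => w _; rewrite lee_fin sqr_ge0.
- apply: (measurable_fun_fubini_tonelli_G f) => //.
  by move=> z; rewrite lee_fin sqr_ge0.
- by move=> t _; rewrite mule_ge0.
- exact: measurable_funeM.
apply: filterS aeX => t ht _.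
apply: (second_moment_le hxi (cY := field_coef lambda phi ^~ t)
  (cZ := fun l i => field_coef lambda phi i (node A l)) (v := fun l => weight A l t)) => //.
  exact: mXt.
move=> F; exact: (sum_fset_le_nneseries codeK F (fun i => sqr_ge0 (field_coef
  lambda phi i t - Defs.approximation A (field_coef lambda phi i) t))).
Qed.

End field.

(** * Size of the coefficients *)
Lemma lambda_sqr_le (R : realType) (lambda : nat -> R) (mu r q : R) :
  (forall i, 0 <= lambda i) -> 0 < mu -> 0 < r ->
  lambda ~_\oo (fun i => mu * i%:R `^ (- r) * ln i%:R `^ q) ->
  exists2 C : R, 0 < C &
    forall i, lambda i ^+ 2 <= C * log_weight (q / r) i `^ (2 * r).
Proof.
move=> l0 mu0 r0 /equivOLR/eqO_exP[k k0 [N0 _ hN]].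
pose V i := log_weight (q / r) i `^ (2 * r).
have V0 i : 0 < V i by rewrite powR_gt0 ?log_weight_gt0.
pose B := 2^-1 `^ (- r) + 1 `^ (- r).
pose B' := 2^-1 `^ q + 1 `^ q.
have B0 : 0 < B by rewrite addr_gt0 ?powR_gt0 ?invr_gt0.
have B'0 : 0 < B' by rewrite addr_gt0 ?powR_gt0 ?invr_gt0.
pose K := k * (mu * B * B').
have K0 : 0 < K by rewrite !mulr_gt0.
pose N := maxn N0 2.
have C00 : 0 <= \sum_(i < N) lambda i ^+ 2 / V i.
  by apply: sumr_ge0 => i _; rewrite divr_ge0 ?sqr_ge0// ltW.
exists (K ^+ 2 + \sum_(i < N) lambda i ^+ 2 / V i).
  by rewrite ltr_wpDr// exprn_gt0.
move=> i; rewrite -/(V i) mulrDl; have [iN|Ni] := ltnP i N.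
  apply: ler_wpDl; first by rewrite mulr_ge0 ?sqr_ge0// ltW.
  rewrite -ler_pdivrMr//.
  apply: (@sumr_ge_term _ _ xpredT (fun i : 'I_N => lambda i ^+ 2 / V i) (Ordinal iN)) => // j _.
  by rewrite divr_ge0 ?sqr_ge0// ltW.
apply: ler_wpDr; first by rewrite mulr_ge0// ltW.
have [i2 iN0] : (2 <= i)%N /\ (N0 <= i)%N.
  by move: Ni; rewrite /N geq_max => /andP[].
have -> : V i = (i.+1%:R `^ (- r) * ln i.+2%:R `^ q) ^+ 2.
  rewrite /V weight_powE exprMn -!powR_mulrn ?powR_ge0// -!powRrM.
  by congr (_ `^ _ * _ `^ _); field; rewrite ?gt_eqF.
rewrite -exprMn lerXn2r ?nnegrE//.
  by rewrite !mulr_ge0 ?powR_ge0// ltW.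
have := hN i iN0; rewrite /= !ger0_norm ?mulr_ge0 ?powR_ge0 ?(ltW mu0)//.
move=> /le_trans; apply; rewrite /K -[leRHS]mulrA ler_wpM2l ?(ltW k0)//.
have i10 : 0 < i.+1%:R :> R by rewrite ltr0n.
have h1 : i%:R `^ (- r) <= B * i.+1%:R `^ (- r).
  apply: powR_le_comparable; rewrite ?invr_gt0// mul1r ler_nat leqnSn andbT.
  by rewrite ler_pdivrMl// -natrM ler_nat; move: i2; clear; lia.
have h2 : ln i%:R `^ q <= B' * ln i.+2%:R `^ q.
  apply: powR_le_comparable; rewrite ?invr_gt0 ?ln_nat_gt0// mul1r.
  have i0 : (0 < i)%N by exact: ltnW.
  rewrite (ln_nat_le _ i0) ?leqW// andbT ler_pdivrMl//.
  have -> : 2 * ln i%:R = ln (i%:R ^+ 2) :> R.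
    by rewrite lnXn ?ltr0n// mulr_natl.
  by rewrite -natrX ln_nat_le//; move: i2; clear; rewrite expnS expn1; nia.
rewrite -!mulrA ler_wpM2l ?(ltW mu0)//.
apply: le_trans (ler_pM _ _ h1 h2) _; rewrite ?powR_ge0//.
by rewrite le_eqVlt; apply/orP; left; apply/eqP; ring.
Qed.

Lemma ler_sum_subseq (R : realType) (I : eqType) (U s : seq I) (a : I -> R) :
  uniq U -> {subset U <= s} -> (forall i, 0 <= a i) ->
  \sum_(i <- U) a i <= \sum_(i <- s) a i.
Proof.
move=> + + a0; elim: U s => [|x U IH] s.
  by move=> _ _; rewrite big_nil sumr_ge0.
move=> /= /andP[xU uU] Us.
have xs : x \in s by apply: Us; rewrite mem_head.
rewrite big_cons (perm_big _ (perm_to_rem xs)) big_cons lerD2l; apply: IH => // y yU.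
have : y \in x :: rem x s by rewrite -(perm_mem (perm_to_rem xs)) Us// in_cons yU orbT.
by rewrite in_cons => /predU1P[yx|//]; move: xU; rewrite -yx yU.
Qed.

Section sum_over_field_index.
Context (R : realType) (d b : nat).
Context (code : field_index d b -> nat) (decode : nat -> option (field_index d b)).
Hypothesis decodeK : forall n i, decode n = Some i -> code i = n.

Definition field_index_of N (A : subsets_of_card d b)
    (k : {ffun {a : 'I_d | a \in val A} -> 'I_N.+1}) : field_index d b :=
  existT _ A [ffun a => k a : nat].

(** A partial sum of the series involves finitely many multi-indices, hence
    bounded entries. *)
Lemma nneseries_field_index_le (f : field_index d b -> R) (B : R) :
  (forall i, 0 <= f i) ->
  (forall N, \sum_(A : {A : {set 'I_d} | #|A| == b})
     \sum_(k : {ffun {a : 'I_d | a \in val A} -> 'I_N.+1})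
       f (field_index_of k) <= B) ->
  (\sum_(n <oo) (oapp f 0 (decode n))%:E <= B%:E)%E.
Proof.
move=> f0 hB.
have of0 n : 0 <= oapp f 0 (decode n) by case: (decode n) => //=.
apply: lime_le.
  by apply: is_cvg_nneseries => n _ _; rewrite lee_fin.
apply: nearW => K; rewrite sumEFin lee_fin.
set U := pmap decode (index_iota 0 K).
rewrite [leLHS](_ : _ = \sum_(i <- U) f i); last by rewrite big_pmap.
have uU : uniq U.
  apply: (@pmap_uniq _ _ _ code); last by rewrite iota_uniq.
  by move=> n /=; case E : (decode n) => [i|//] /=; exact: decodeK.
pose N := (\max_(i <- U) \max_(a : {a : 'I_d | a \in val (tag i)}) (tagged i a))%N.
apply: le_trans (hB N).
rewrite sig_big_dep /=.
pose e (p : {A : {A : {set 'I_d} | #|A| == b} & {ffun {a : 'I_d | a \in val A} -> 'I_N.+1}}) :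
  field_index d b := field_index_of (tagged p).
rewrite -(big_map e xpredT f).
apply: ler_sum_subseq => // -[A k] iU; apply/mapP.
have kN a : (k a < N.+1)%N.
  rewrite ltnS; apply: leq_trans (leq_bigmax_seq _ iU isT) => /=.
  exact: (leq_bigmax a).
exists (existT _ A [ffun a => Ordinal (kN a)]); first by rewrite mem_index_enum.
by congr existT; apply/ffunP => a; rewrite !ffunE.
Qed.

End sum_over_field_index.

(** * Algorithms with a given trial space *)
Section algorithm.
Context (R : realType) (d b : nat) (phi : nat -> R -> R) (lambda : nat -> R).
Hypothesis hphi : orthonormal_basis (@unit_lebesgue R) phi.
Hypothesis hphi0 : forall u : R, u \in `[0, 1] -> phi 0%N u = 1.
Context (disp : measure_display) (T : measurableType disp) (P : probability T R).
Context (xi : field_index d b -> {RV P >-> R}) (X : T -> d.-tuple R -> R).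
Hypothesis hxi : standard_noncorrelated xi.
Hypothesis hX : additive_random_field lambda phi xi X.

Definition amplitude (i : field_index d b) : R :=
  let: existT A k := i in \prod_a lambda (k a).

(** As [phi 0 = 1], indices attached to different subsets of coordinates may be
    padded by zeros to index the same tensor product. *)
Definition extend (i : field_index d b) : 'I_d -> nat :=
  let: existT A k := i in fun a => oapp k 0%N (insub a).

Lemma field_coefE i t : unit_cube t ->
  field_coef lambda phi i t = amplitude i * tensor phi (extend i) t.
Proof.
case: i => A k ut; rewrite /field_coef /amplitude /tensor /=; congr (_ * _).
rewrite [RHS](bigID (fun a => a \in val A)) /= [X in _ * X]big1 ?mulr1; last first.
  by move=> a aA; rewrite insubN//= hphi0.
rewrite (big_sub (val A) (fun a => phi (oapp k 0%N (insub a)) (tnth t a))).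
by apply: eq_bigr => a _; rewrite valK.
Qed.

Context (code : field_index d b -> nat) (decode : nat -> option (field_index d b)).
Hypothesis codeK : pcancel code decode.
Hypothesis decodeK : forall n i, decode n = Some i -> code i = n.

(** The trial space is spanned by the tensor products with index in [S].  The
    index 0 belongs to [S] in order that [\sum_j E j t ^+ 2 > 0] on the cube.
    The constants arise from two applications of [(u + v)^2 <= 2 u^2 + 2 v^2]:
    one in passing from the field to its coefficients, the other in separating
    the tail.  The Kaczmarz bound is used with [2 * D] because it needs a strict
    inequality. *)
Lemma exists_algorithm (N : nat) (S : pred {ffun 'I_d -> 'I_N.+1})
    (D W : R) (n : nat) :
  S [ffun=> ord0] -> 0 < D ->
  let inS i := [exists j : {ffun 'I_d -> 'I_N.+1}, S j && [forall a, extend i a == j a :> nat]] in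
  (forall K, \sum_(A : {A : {set 'I_d} | #|A| == b})
     \sum_(k : {ffun {a : 'I_d | a \in val A} -> 'I_K.+1})
       amplitude (field_index_of k) ^+ 2 <= W) ->
  (forall K, \sum_(A : {A : {set 'I_d} | #|A| == b})
     \sum_(k : {ffun {a : 'I_d | a \in val A} -> 'I_K.+1} | ~~ inS (field_index_of k))
       amplitude (field_index_of k) ^+ 2 <= D) ->
  exists A : linear_algorithm R d n,
    (mean_square_error P X A <=
      (12 * D + 4 * (W * (1 - #|S|%:R^-1) ^+ n))%:E)%E.
Proof.
move=> S0 D0 inS hW hD.
pose I : finType := {j : {ffun 'I_d -> 'I_N.+1} | S j}.
have cardI : #|I| = #|S| by rewrite card_sig; exact: eq_card.
pose E (j : I) : d.-tuple R -> R := tensor phi (fun a => val j a).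
have mE j : measurable_fun setT (E j) by exact: measurable_tensor.
have orthE i j : (\int[cube_lebesgue R d]_t (E i t * E j t)%:E = ((i == j)%:R)%:E)%E.
  have [_ ->] := tensor_orthonormal hphi (fun a => val i a) (fun a => val j a).
  congr ((nat_of_bool _)%:R)%:E; rewrite -val_eqE /=; apply/esym.
  apply/idP/idP => [/eqP ->|/forallP ij]; first by apply/forallP.
  by apply/eqP/ffunP => a; apply/val_inj/eqP/ij.
have intE i j := (tensor_orthonormal hphi (fun a => val (i : I) a) (fun a => val (j : I) a)).1.
pose mss t := mean_square_sum P (field_coef lambda phi ^~ t) xi (X ^~ t).
pose G := [set t | unit_cube t /\ mss t].
have aeG : {ae cube_lebesgue R d, forall t, G t}.
  by case: hX => _; apply: filterS2 (ae_unit_cube R d) => t ? ?; split.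
have Gs t : G t -> 0 < \sum_j E j t ^+ 2.
  move=> [ut _]; pose j0 : I := Sub [ffun=> ord0] S0.
  apply: (@lt_le_trans _ _ (E j0 t ^+ 2)).
    rewrite /E /tensor big1 ?expr1n// => a _.
    by rewrite SubK ffunE /= hphi0.
  by apply: (@sumr_ge_term _ _ xpredT (fun j => E j t ^+ 2)) => // j _; rewrite sqr_ge0.
(* [c = y + combination E x]: a coefficient function is either an element of
   the trial space or a part of the tail *)
pose c m t := oapp (fun i => field_coef lambda phi i t) 0 (decode m).
pose y m t := oapp (fun i => if inS i then 0 else amplitude i * tensor phi (extend i) t) 0 (decode m).
pose x m (j : I) : R :=
  oapp (fun i => amplitude i *+ [forall a, extend i a == val j a :> nat]) 0 (decode m).
have cE m t : G t -> c m t = y m t + combination E (x m) t.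
  move=> [ut _]; rewrite /c /y /x /combination; case: (decode m) => [i|] /=; last first.
    by rewrite add0r big1// => j _; rewrite mul0r.
  rewrite field_coefE//; have [/existsP[j /andP[Sj /forallP ij]]|/existsPn ni] := boolP (inS i).
    rewrite add0r (bigD1 (Sub j Sj : I))//= big1 ?addr0; last first.
      move=> j' j'j; rewrite (negPf (_ : ~~ [forall a, _])) ?mulr0n ?mul0r//.
      apply: contra j'j => /forallP ij'; rewrite -val_eqE /=; apply/eqP/ffunP => a.
      by apply/val_inj; rewrite /= -(eqP (ij' a)) (eqP (ij a)).
    rewrite (introT forallP ij) mulr1n; congr (_ * _).
    by apply: eq_bigr => a _; rewrite (eqP (ij a)).
  rewrite big1 ?addr0// => j _.
  by have := ni (val j); rewrite (valP j)/= => /negPf ->; rewrite mulr0n mul0r.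
have my m : measurable_fun setT (y m).
  rewrite /y; case: (decode m) => [i|] /=; last exact: measurable_cst.
  case: (inS i) => /=; first exact: measurable_cst.
  by apply: measurable_funM; [exact: measurable_cst|exact: measurable_tensor].
have ytail : (\sum_(m <oo) \int[cube_lebesgue R d]_t (y m t ^+ 2)%:E <= D%:E)%E.
  pose f i := if inS i then 0 else amplitude i ^+ 2.
  have f0 i : 0 <= f i by rewrite /f; case: ifP => // _; exact: sqr_ge0.
  apply: le_trans (nneseries_field_index_le decodeK f0 (B := D) _); last first.
    move=> K; apply: le_trans (hD K); apply: ler_sum => A _.
    by rewrite [leRHS]big_mkcond; apply: ler_sum => k _; rewrite /f if_neg.
  rewrite le_eqVlt; apply/orP; left; apply/eqP; apply: eq_eseriesr => m _.
  rewrite /y /f; case: (decode m) => [i|] /=; last first.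
    by under eq_integral do rewrite expr0n /=; rewrite integral0.
  case: (inS i) => /=.
    by under eq_integral do rewrite expr0n /=; rewrite integral0.
  under eq_integral do rewrite exprMn EFinM.
  rewrite ge0_integralZl_EFin ?sqr_ge0//; last 2 first.
    by move=> t _; rewrite lee_fin sqr_ge0.
    by apply/measurable_EFinP/measurable_funX; exact: measurable_tensor.
  under eq_integral do rewrite expr2.
  have [_ ->] := tensor_orthonormal hphi (extend i) (extend i).
  by rewrite (introT forallP (fun a => eqxx _)) mule1.
have xW : (\sum_(m <oo) (sqnorm (x m))%:E <= W%:E)%E.
  apply: le_trans (nneseries_field_index_le decodeK (fun i => sqr_ge0 (amplitude i)) hW).
  apply: lee_nneseries => [m _ _|m _]; first by rewrite lee_fin sqnorm_ge0.
  rewrite lee_fin /sqnorm /x; case: (decode m) => [i|] /=; last first.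
    by rewrite big1// => j _; rewrite expr0n.
  have [/existsP[j ij]|/existsPn ni] := boolP [exists j : I, [forall a, extend i a == val j a :> nat]].
    rewrite (bigD1 j)//= ij mulr1n big1 ?addr0// => j' j'j.
    rewrite (negPf (_ : ~~ [forall a, _])) ?mulr0n ?expr0n//.
    apply: contra j'j => /forallP ij'; rewrite -val_eqE /=; apply/eqP/ffunP => a.
    by apply/val_inj; rewrite /= -(eqP (ij' a)) (eqP (forallP ij a)).
  by rewrite big1 ?sqr_ge0// => j _; rewrite (negPf (ni j)) mulr0n expr0n.
have ytail2 : (\sum_(m <oo) \int[cube_lebesgue R d]_t (y m t ^+ 2)%:E < (2 * D)%:E)%E.
  by apply: le_lt_trans ytail _; rewrite lte_fin; lra.
have [sm [smn smG smE]] := exists_sampling mE intE orthE aeG Gs my cE ytail2 xW n.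
rewrite cardI in smE.
pose p0 : d.-tuple R * (I -> R) := ([tuple of nseq d 0], fun=> 0).
have node_G l : (l < n)%N -> G (nth p0 sm l).1.
  move=> ln; apply: smG; rewrite -(nth_map p0 p0.1 fst) ?smn//.
  by apply: mem_nth; rewrite size_map smn.
have comb_L2 (v : I -> R) : combination E v \in Lfun (cube_lebesgue R d) 2%:E.
  apply: Lfun2P; first exact: measurable_combination.
  by rewrite (integral_combination_sqr intE orthE) ltry.
pose A := LinearAlgorithm (fun l : 'I_n => (node_G l (ltn_ord l)).1)
  (fun l : 'I_n => comb_L2 (nth p0 sm l).2).
exists A.
have AE f t : Defs.approximation A f t = combination E (sampling sm f) t.
  rewrite /Defs.approximation /combination /sampling /=.
  under [RHS]eq_bigr do rewrite mulr_suml.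
  rewrite exchange_big /= (big_nth p0) big_mkord smn.
  apply: eq_bigr => l _; rewrite mulr_sumr.
  by apply: eq_bigr => j _; rewrite mulrA.
pose z m j := x m j - sampling sm (c m) j.
have combz m t : combination E (z m) t =
    combination E (x m) t - combination E (sampling sm (c m)) t.
  rewrite /combination -sumrB; apply: eq_bigr => j _.
  by rewrite /z mulrBl.
apply: le_trans (mean_square_error_le hphi hxi hX codeK _) _.
  by move=> l; have [_] := node_G l (ltn_ord l).
have sqy m t : (0 <= (y m t ^+ 2)%:E)%E by rewrite lee_fin sqr_ge0.
have sqz m t : (0 <= (combination E (z m) t ^+ 2)%:E)%E by rewrite lee_fin sqr_ge0.
have msqy m : measurable_fun setT (fun t => (y m t ^+ 2)%:E).
  by apply/measurable_EFinP; exact: measurable_funX.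
have msqz m : measurable_fun setT (fun t => (combination E (z m) t ^+ 2)%:E).
  by apply/measurable_EFinP/measurable_funX; exact: measurable_combination.
pose h t := (\sum_(m <oo) (2%:E * (y m t ^+ 2)%:E + 2%:E * (combination E (z m) t ^+ 2)%:E))%E.
have h0 m t : (0 <= 2%:E * (y m t ^+ 2)%:E + 2%:E * (combination E (z m) t ^+ 2)%:E)%E.
  by rewrite adde_ge0// mule_ge0.
have mh m : measurable_fun setT
    (fun t => 2%:E * (y m t ^+ 2)%:E + 2%:E * (combination E (z m) t ^+ 2)%:E)%E.
  by apply: emeasurable_funD; apply: measurable_funeM.
have Ih : (\int[cube_lebesgue R d]_t h t <= (2 * D + 2 * (W * (1 - #|S|%:R^-1) ^+ n + 2 * D))%:E)%E.
  rewrite integral_nneseries//.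
  under eq_eseriesr => m _.
    rewrite ge0_integralD//; last 4 first.
    - by move=> t _; rewrite mule_ge0.
    - exact: measurable_funeM.
    - by move=> t _; rewrite mule_ge0.
    - exact: measurable_funeM.
    rewrite !ge0_integralZl_EFin// (integral_combination_sqr intE orthE).
    over.
  have iy0 m : (0 <= \int[cube_lebesgue R d]_t (y m t ^+ 2)%:E)%E by apply: integral_ge0.
  have sz0 m : (0 <= (sqnorm (z m))%:E)%E by rewrite lee_fin sqnorm_ge0.
  rewrite nneseriesD; [|by move=> m _ _; rewrite mule_ge0|by move=> m _ _; rewrite mule_ge0].
  rewrite !nneseriesZl//.
  apply: (@le_trans _ _ (2%:E * D%:E + 2%:E * (W * (1 - #|S|%:R^-1) ^+ n + 2 * D)%:E)%E); last first.
    by rewrite -!EFinM -EFinD lexx.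
  apply: leeD.
    by apply: lee_wpmul2l; rewrite ?lee_fin.
  by apply: lee_wpmul2l; rewrite ?lee_fin.
apply: (@le_trans _ _ (2%:E * (2 * D + 2 * (W * (1 - #|S|%:R^-1) ^+ n + 2 * D))%:E)%E); last first.
  by rewrite -EFinM lee_fin le_eqVlt; apply/orP; left; apply/eqP; ring.
apply: lee_wpmul2l; rewrite ?lee_fin//; apply: le_trans Ih.
have o0 m t : 0 <= oapp (fun i => (field_coef lambda phi i t -
      Defs.approximation A (field_coef lambda phi i) t) ^+ 2) 0 (decode m).
  by case: (decode m) => [i|] //=; rewrite sqr_ge0.
apply: ae_ge0_le_integral => //.
- by move=> t _; apply: nneseries_ge0 => m _ _; rewrite lee_fin.
- apply: ge0_emeasurable_sum => [m t _ _|m _]; first by rewrite lee_fin.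
  apply/measurable_EFinP; case: (decode m) => [i|] /=; last exact: measurable_cst.
  apply: measurable_funX; apply: measurable_funB; first exact: measurable_field_coef.
  rewrite (_ : Defs.approximation A _ = combination E (sampling sm (field_coef lambda phi i))).
    exact: measurable_combination.
  by apply/funext => t; exact: AE.
- by move=> t _; apply: nneseries_ge0.
- by apply: ge0_emeasurable_sum.
apply: filterS aeG => t Gt _.
apply: lee_nneseries => [m _ _|m _]; first by rewrite lee_fin.
have : 0 <= 2 * y m t ^+ 2 + 2 * combination E (z m) t ^+ 2.
  by rewrite addr_ge0// mulr_ge0// sqr_ge0.
rewrite -!EFinM -EFinD lee_fin combz.
have := cE m t Gt; rewrite /c; case: (decode m) => [i|] //= -> _.
rewrite AE; set u := combination E (x m) t; set v := combination E _ t.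
have := sqr_ge0 (y m t - (u - v)); rewrite !expr2; lra.
Qed.

End algorithm.

(** * Algorithms built on a weighted hyperbolic cross *)
Section cross_algorithm.
Context (R : realType) (d b : nat) (phi : nat -> R -> R) (lambda : nat -> R).
Hypothesis hphi : orthonormal_basis (@unit_lebesgue R) phi.
Hypothesis hphi0 : forall u : R, u \in `[0, 1] -> phi 0%N u = 1.
Context (disp : measure_display) (T : measurableType disp) (P : probability T R).
Context (xi : field_index d b -> {RV P >-> R}) (X : T -> d.-tuple R -> R).
Hypothesis hxi : standard_noncorrelated xi.
Hypothesis hX : additive_random_field lambda phi xi X.
Context (g r C0 H W0 : R).
Local Notation h := (@log_weight R g).
Local Notation V i := (h i `^ (2 * r)).
Hypothesis C00 : 0 < C0.
Hypothesis lambda_le : forall i, lambda i ^+ 2 <= C0 * V i.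
Hypothesis H1 : 1 <= H.
Hypothesis hH : forall i, h i <= H.
Hypothesis hW0 : forall N, \sum_(i < N) V i <= W0.
Hypothesis b0 : (0 < b)%N.

Local Notation slots A := {a : 'I_d | a \in val (A : {A : {set 'I_d} | #|A| == b})}.
Local Notation nb_sets := #|{: {A : {set 'I_d} | #|A| == b}}|.

Lemma card_slots (A : {A : {set 'I_d} | #|A| == b}) : #|{: slots A}| = b.
Proof.
rewrite card_sig; transitivity #|val A|; first exact: eq_card.
exact/eqP/(valP A).
Qed.

Lemma amplitude_sqr_le_prod (A : subsets_of_card d b) (k : multi_index (val A)) :
  amplitude lambda (existT _ A k) ^+ 2 <= C0 ^+ b * \prod_a V (k a).
Proof.
rewrite /= -prodrXl -[X in _ ^+ X](card_slots A) -prodr_const -big_split /=.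
by apply: ler_prod => a _; rewrite sqr_ge0 lambda_le.
Qed.

Lemma amplitude_field_index_of_le N (A : {A : {set 'I_d} | #|A| == b})
    (k : {ffun slots A -> 'I_N.+1}) :
  amplitude lambda (field_index_of k) ^+ 2 <= C0 ^+ b * \prod_a V (k a).
Proof.
have kE : \prod_a V ([ffun a => k a : nat] a) = \prod_a V (k a).
  by apply: eq_bigr => a _; rewrite (ffunE (fun a => k a : nat)); reflexivity.
rewrite -kE; exact: amplitude_sqr_le_prod.
Qed.

(** The index 0 is added by hand, as the cross may be empty for small [Th]. *)
Definition trial_index N (Th : R) : pred {ffun 'I_d -> 'I_N.+1} := fun j =>
  (j == [ffun=> ord0]) ||
  [exists p : {A : {A : {set 'I_d} | #|A| == b} & {ffun slots A -> 'I_N.+1}},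
     cross g Th (fun c => tagged p c) &&
     [forall a, extend (field_index_of (tagged p)) a == j a :> nat]].

Lemma card_trial_index_le N (Th : R) : 0 <= Th ->
  #|@trial_index N Th|%:R <=
    1 + nb_sets%:R * (b%:R * (Th * (\sum_(i < N.+1) h i) ^+ b.-1)).
Proof.
move=> Th0.
pose Q := [pred p : {A : {A : {set 'I_d} | #|A| == b} & {ffun slots A -> 'I_N.+1}} |
  cross g Th (fun c => tagged p c)].
pose f (o : option {p | Q p}) : {ffun 'I_d -> 'I_N.+1} :=
  if o is Some p then [ffun a => inord (extend (field_index_of (tagged (val p))) a)]
  else [ffun=> ord0].
have /subset_leq_card : @trial_index N Th \subset codom f.
  apply/fintype.subsetP => j; rewrite unfold_in => /orP[/eqP ->|/existsP[p /andP[Qp /forallP pj]]].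
    exact: (codom_f f None).
  rewrite (_ : j = f (Some (Sub p Qp))) ?codom_f//.
  by apply/ffunP => a; apply/val_inj; rewrite /f SubK ffunE (eqP (pj a)) inord_val.
rewrite -(ler_nat R) => /le_trans; apply.
apply: (@le_trans _ _ (#|{: option {p | Q p}}|%:R)).
  by rewrite ler_nat leq_image_card.
rewrite card_option -natr1 addrC lerD2l card_sig -sum1_card natr_sum.
rewrite [leLHS](_ : _ = \sum_(A : {A : {set 'I_d} | #|A| == b})
    \sum_(k : {ffun slots A -> 'I_N.+1} | cross g Th (fun c => k c)) 1); last first.
  by rewrite sig_big_dep; apply: eq_bigl.
rewrite -sum1_card natr_sum mulr_suml; apply: ler_sum => A _; rewrite mul1r.
have bA := card_slots A.
have := card_cross_le g N Th0 (_ : 0 < #|{: slots A}|)%N.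
rewrite bA => /(_ b0); apply: le_trans.
by rewrite -sum1_card natr_sum.
Qed.

(** [nb_sets.+1] rather than [nb_sets] makes the bound on the tail positive,
    since the number of subsets may be 0 for general [d] and [b]. *)
Lemma exists_cross_algorithm n (Th D : R) : (0 < n)%N -> 0 < D -> 0 <= Th ->
  Th * H ^+ b <= n%:R ->
  (forall (J : finType) K, #|J| = b ->
    \sum_(k : {ffun J -> 'I_K.+1} | ~~ cross g Th (fun c => k c))
       \prod_c V (k c) <= D) ->
  exists (A : linear_algorithm R d n) (M : nat),
    [/\ (0 < M)%N,
      M%:R <= 1 + nb_sets%:R * (b%:R * (Th * (\sum_(i < n) h i) ^+ b.-1)) &
      (mean_square_error P X A <=
        (12 * (nb_sets.+1%:R * C0 ^+ b * D) +
         4 * (nb_sets%:R * C0 ^+ b * W0 ^+ b * (1 - M%:R^-1) ^+ n))%:E)%E].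
Proof.
move=> n0 D0 Th0 ThH hD.
have [code [decode [codeK decodeK]]] := field_index_enumeration d b.
case: n n0 ThH => // N _ ThH.
have V0 i : 0 <= V i by exact: powR_ge0.
have C0b : 0 < C0 ^+ b by rewrite exprn_gt0.
have DD0 : 0 < nb_sets.+1%:R * C0 ^+ b * D by rewrite !mulr_gt0 ?ltr0Sn.
have W1 : 0 <= W0 by apply: le_trans (hW0 0); rewrite big_ord0.
pose inS (i : field_index d b) := [exists j : {ffun 'I_d -> 'I_N.+1},
  @trial_index N Th j && [forall a, extend i a == j a :> nat]].
have cross_in A K (k : {ffun slots A -> 'I_K.+1}) :
    cross g Th (fun c => k c) -> inS (field_index_of k).
  move=> kT; have kN c : (k c < N.+1)%N.
    by apply: (cross_lt (k := fun c => k c) c H1 hH Th0 _ kT); rewrite card_slots.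
  have eN a : (extend (field_index_of k) a < N.+1)%N.
    by rewrite /=; case: insub => [a'|] //=; rewrite ffunE.
  apply/existsP; exists [ffun a => Ordinal (eN a)].
  apply/andP; split; last by apply/forallP => a; rewrite ffunE.
  apply/orP; right; apply/existsP; exists (existT _ A [ffun c => Ordinal (kN c)]).
  apply/andP; split => /=.
    rewrite [X in cross _ _ X](_ : _ = (fun c => k c : nat))//.
    by apply/funext => c; rewrite ffunE.
  apply/forallP => a; rewrite ffunE /=; case: insub => [a'|] //=.
  by rewrite !ffunE.
have := @exists_algorithm _ _ _ _ _ hphi hphi0 _ _ _ _ _ hxi hX _ _ codeK decodeK N
  (@trial_index N Th) (nb_sets.+1%:R * C0 ^+ b * D) (nb_sets%:R * (C0 ^+ b * W0 ^+ b)) N.+1.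
case.
- by rewrite /trial_index eqxx.
- exact: DD0.
- move=> K; rewrite -sum1_card natr_sum mulr_suml; apply: ler_sum => A _; rewrite mul1r.
  apply: (@le_trans _ _ (\sum_(k : {ffun slots A -> 'I_K.+1}) C0 ^+ b * \prod_a V (k a))).
    by apply: ler_sum => k _; exact: amplitude_field_index_of_le.
  rewrite -mulr_sumr ler_wpM2l ?(ltW C0b)//.
  rewrite -(bigA_distr_bigA (fun (a : slots A) (i : 'I_K.+1) => V i)) prodr_const card_slots.
  by rewrite lerXn2r ?nnegrE ?sumr_ge0.
- move=> K; apply: (@le_trans _ _ (\sum_(A : {A : {set 'I_d} | #|A| == b}) C0 ^+ b * D)).
    apply: ler_sum => A _.
    apply: le_trans (ler_wpM2l (ltW C0b) (hD _ K (card_slots A))).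
    rewrite mulr_sumr big_mkcond [leRHS]big_mkcond; apply: ler_sum => k _.
    have pV0 : 0 <= C0 ^+ b * \prod_c V (k c) by rewrite mulr_ge0 ?(ltW C0b) ?prodr_ge0.
    have [kT|_] := boolP (cross g Th (fun c => k c)).
      by rewrite ifN// negbK; exact: cross_in.
    by case: ifP => // _; exact: amplitude_field_index_of_le.
  rewrite sumr_const -[leLHS]mulr_natl -mulrA ler_wpM2r ?mulr_ge0 ?(ltW C0b) ?(ltW D0)//.
  by rewrite ler_nat leqnSn.
move=> A hA; exists A, #|@trial_index N Th|; split.
- by apply/card_gt0P; exists [ffun=> ord0]; rewrite unfold_in /trial_index eqxx.
- exact: card_trial_index_le.
by apply: le_trans hA _; rewrite lee_fin -!mulrA.
Qed.

End cross_algorithm.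

(** * Choice of the threshold *)
Section parameters.
Context (R : realType).

(** The third inequality says that [1 + K * (T * (ln n)^kappa)], the size of the
    trial space, is at most [n / (2 r ln n)]; it fixes the exponent
    [- (kappa + 1)] of the logarithm and one summand of the constant [c'].  The
    other summand gives the second inequality, and the first holds for large [n]
    for any value of the constant. *)
Lemma exists_threshold (K B r kappa : R) : 0 <= K -> 0 < B -> 0 < r -> 0 <= kappa ->
  exists2 c : R, 0 < c & exists n0, forall n, (n0 <= n)%N -> (2 <= n)%N ->
    let T := c * n%:R * ln n%:R `^ (- (kappa + 1)) in
    [/\ n%:R `^ 2^-1 <= T, T * B <= n%:R &
        2 * r * ln n%:R * (1 + K * (T * ln n%:R `^ kappa)) <= n%:R].
Proof.
move=> K0 B0 r0 k0.
have l20 : 0 < ln 2 :> R by rewrite ln_gt0// ltr1n.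
have k10 : 0 < kappa + 1 by rewrite ltr_wpDl.
pose L := ln 2 `^ (- (kappa + 1)); have L0 : 0 < L by rewrite powR_gt0.
have [C C0 hC] := @powR_ln_le R (kappa + 1) 4^-1 (ltac:(by rewrite invr_gt0)).
pose c' := 4 * r * (K + 1) + B * L.
have c'0 : 0 < c' by rewrite addr_gt0 ?mulr_gt0// ltr_wpDl.
exists c'^-1; first by rewrite invr_gt0.
exists (maxn (Num.truncn ((C * c') ^+ 4)).+1 (Num.truncn ((8 * r) ^+ 2)).+1).
move=> n; rewrite geq_max => /andP[nC nr] n2 T.
have n0 : 0 < n%:R :> R by rewrite ltr0n (leq_trans _ n2).
have {nC} nC : (C * c') ^+ 4 <= n%:R.
  apply: le_trans (_ : (Num.truncn ((C * c') ^+ 4)).+1%:R <= _); rewrite ?ler_nat//.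
  by rewrite ltW// truncnS_gt.
have {nr} nr : (8 * r) ^+ 2 <= n%:R.
  apply: le_trans (_ : (Num.truncn ((8 * r) ^+ 2)).+1%:R <= _); rewrite ?ler_nat//.
  by rewrite ltW// truncnS_gt.
have ln2n : ln 2 <= ln n%:R :> R by exact: ln_nat_le.
have l0 : 0 < ln n%:R :> R by exact: lt_le_trans ln2n.
set l := ln n%:R in ln2n l0 *.
have lk0 : 0 < l `^ (kappa + 1) by rewrite powR_gt0.
have TE : T = n%:R / (c' * l `^ (kappa + 1)).
  by rewrite /T powRN invfM; ring.
have root (x : R) m : 0 <= x -> x ^+ m.+1 <= n%:R -> x <= n%:R `^ m.+1%:R^-1.
  move=> x0 xn; have {1}-> : x = (x ^+ m.+1) `^ m.+1%:R^-1.
    by rewrite -powR_mulrn// -powRrM mulfV ?pnatr_eq0// powRr1.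
  by apply: ge0_ler_powR; rewrite ?nnegrE ?exprn_ge0 ?invr_ge0.
split.
- rewrite TE ler_pdivlMr ?mulr_gt0//.
  have nE : n%:R = n%:R `^ 2^-1 * (n%:R `^ 4^-1 * n%:R `^ 4^-1) :> R.
    rewrite -!powRD ?(gt_eqF n0) ?implybT//.
    by rewrite -[LHS]powRr1 ?(ltW n0)//; congr (_ `^ _); field.
  rewrite [leRHS]nE ler_wpM2l ?powR_ge0//.
  apply: (@le_trans _ _ (c' * (C * n%:R `^ 4^-1))).
    by rewrite ler_wpM2l ?(ltW c'0)// hC// ler_nat.
  rewrite mulrCA mulrA ler_wpM2r ?powR_ge0//.
  by apply: root => //; rewrite mulr_ge0 ?(ltW C0) ?(ltW c'0).
- rewrite TE mulrAC ler_pdivrMr ?mulr_gt0// ler_wpM2l ?(ltW n0)//.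
  apply: (@le_trans _ _ (B * L * l `^ (kappa + 1))); last first.
    by rewrite ler_wpM2r ?(ltW lk0)// lerDr !mulr_ge0 ?(ltW r0) ?addr_ge0.
  rewrite -mulrA ler_peMr ?(ltW B0)// /L powRN ler_pdivlMl ?powR_gt0// mulr1.
  by apply: ge0_ler_powR; rewrite ?nnegrE ?(ltW k10) ?(ltW l20) ?(ltW l0).
have TlE : T * l `^ kappa = n%:R / (c' * l).
  rewrite TE powRD ?(gt_eqF l0) ?implybT// powRr1 ?(ltW l0)//.
  by field; rewrite !gt_eqF// powR_gt0.
rewrite TlE mulrDr mulr1.
have h1 : 2 * r * l <= 2^-1 * n%:R.
  have := @ln_le_powR R 2^-1 n%:R (ltac:(by rewrite invr_gt0)) n0; rewrite invrK -/l => hl.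
  have r8 : 8 * r <= n%:R `^ 2^-1 by apply: root => //; rewrite mulr_ge0 ?(ltW r0).
  have nE : n%:R = n%:R `^ 2^-1 * n%:R `^ 2^-1 :> R.
    rewrite -!powRD ?(gt_eqF n0) ?implybT//.
    by rewrite -[LHS]powRr1 ?(ltW n0)//; congr (_ `^ _); field.
  have : r * l <= r * (2 * n%:R `^ 2^-1) by rewrite ler_wpM2l ?(ltW r0).
  have : 8 * r * n%:R `^ 2^-1 <= n%:R by rewrite [leRHS]nE ler_wpM2r ?powR_ge0.
  lra.
have h2 : 2 * r * l * (K * (n%:R / (c' * l))) <= 2^-1 * n%:R.
  have -> : 2 * r * l * (K * (n%:R / (c' * l))) = 2 * r * K / c' * n%:R.
    by field; rewrite !gt_eqF.
  rewrite ler_wpM2r ?(ltW n0)// ler_pdivrMr// /c'.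
  have := ltW (mulr_gt0 B0 L0); have := mulr_ge0 (ltW r0) K0; have := ltW r0; lra.
lra.
Qed.

(** [1 - x <= exp(- x)] *)
Lemma contraction_le (M n : nat) (r : R) : (0 < M)%N -> (0 < n)%N ->
  2 * r * ln n%:R * M%:R <= n%:R -> (1 - M%:R^-1) ^+ n <= n%:R `^ (- (2 * r)) :> R.
Proof.
move=> M0 n0 hM; have M0' : 0 < M%:R :> R by rewrite ltr0n.
apply: (@le_trans _ _ (expR (- M%:R^-1) ^+ n)).
  rewrite lerXn2r ?nnegrE ?expR_ge0//.
    by rewrite subr_ge0 invf_le1// ler1n.
  exact: expR_ge1Dx.
rewrite -expRM_natl /powR pnatr_eq0 gtn_eqF// ler_expR.
by rewrite mulrN mulNr lerN2 ler_pdivlMr.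
Qed.

End parameters.

Theorem proposition4p2 (R : realType) (d b : nat) (hb : (1 <= b <= d)%N)
  (phi : nat -> R -> R)
  (hphi : orthonormal_basis (@unit_lebesgue R) phi)
  (hphi0 : forall u : R, u \in `[0, 1] -> phi 0%N u = 1)
  (lambda : nat -> R) (hlambda : forall i, 0 <= lambda i)
  (mu r q : R) (hmu : 0 < mu) (hr : 1 / 2 < r) (hq : - r < q)
  (hasymp : lambda ~_\oo (fun i => mu * i%:R `^ (- r) * ln i%:R `^ q))
  (disp : measure_display) (T : measurableType disp) (P : probability T R)
  (xi : field_index d b -> {RV P >-> R}) (hxi : standard_noncorrelated xi)
  (X : T -> d.-tuple R -> R)
  (hX : additive_random_field lambda phi xi X) :
  exists (C : R) (A : forall n : nat, linear_algorithm R d n),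
    forall n : nat, (2 <= n)%N ->
      (mean_square_error P X (A n) <=
       (C * n%:R `^ (1 - 2 * r) *
        ln n%:R `^ (2 * b%:R * (r + q) - 1))%:E)%E.
Proof.
case/andP: hb => b0 _.
have r0 : 0 < r by lra.
pose g := q / r.
have g1 : -1 < g by rewrite /g ltr_pdivlMr// mulN1r.
have g10 : 0 < g + 1 by lra.
have [C0 C00 lambda_le] := lambda_sqr_le hlambda hmu r0 hasymp.
have [H H1 hH] := @log_weight_bounded R g.
have [W0 W01 hW0] := @sum_weight_pow_bounded R g r hr.
have W00 : 0 < W0 by lra.
have [C1 C10 hC1] := sum_log_weight_le g1.
have [C2 C20 hC2] := @sum_outside_cross_le R g r hr H b H1 hH b0.
pose NA : R := #|{: {A : {set 'I_d} | #|A| == b}}|%:R.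
pose kappa := (g + 1) * b.-1%:R.
have kappa0 : 0 <= kappa by rewrite mulr_ge0// ltW.
pose K := NA * (b%:R * C1 ^+ b.-1).
have K0 : 0 <= K by rewrite !mulr_ge0 ?exprn_ge0 ?(ltW C10).
have Hb0 : 0 < H ^+ b by rewrite exprn_gt0//; lra.
have [c c0 [n0 hc]] := exists_threshold K0 Hb0 r0 kappa0.
pose E := 2 * b%:R * (r + q) - 1.
pose rate (n : nat) : R := n%:R `^ (1 - 2 * r) * ln n%:R `^ E.
have eta0 : 0 < r - 1 / 2 by lra.
have [C3 C30 hC3] := powR_ln_le (- E) eta0.
have [C4 C40 hC4] := @powR_ln_le R (- E) 1 ltr01.
have algo n Th D := @exists_cross_algorithm _ _ _ _ _ hphi hphi0 _ _ _ _ _ hxi hX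
  g r C0 H W0 C00 lambda_le H1 hH hW0 b0 n Th D.
pose Clarge := 12 * ((NA + 1) * C0 ^+ b * (C2 * (C1 ^+ b.-1 * c `^ (1 - 2 * r) + C3))) +
  4 * (NA * C0 ^+ b * W0 ^+ b * C4).
pose Csmall := 12 * ((NA + 1) * C0 ^+ b * (W0 ^+ b)) + 4 * (NA * C0 ^+ b * W0 ^+ b).
have NA0 : 0 <= NA by [].
have C0b : 0 < C0 ^+ b by rewrite exprn_gt0.
have W0b : 0 < W0 ^+ b by rewrite exprn_gt0.
have Clarge0 : 0 <= Clarge.
  by rewrite /Clarge !(addr_ge0, mulr_ge0, powR_ge0, exprn_ge0) ?(ltW C10) ?(ltW C20)
    ?(ltW C30) ?(ltW C40) ?(ltW C00) ?(ltW W00).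
have Csmall0 : 0 <= Csmall.
  by rewrite /Csmall !(addr_ge0, mulr_ge0) ?(ltW C0b) ?(ltW W0b).
have NA1 : #|{: {A : {set 'I_d} | #|A| == b}}|.+1%:R = NA + 1 :> R by rewrite -natr1.
have rate0 n : (2 <= n)%N -> 0 < rate n.
  move=> n2; rewrite mulr_gt0 ?powR_gt0 ?ltr0n ?(leq_trans _ n2)//.
  by rewrite ln_gt0// ltr1n.
(* the sum makes the constant fit each of the finitely many small [n] *)
exists (Clarge + \sum_(n < n0) Csmall / rate n).
suff hA : forall n, exists A : linear_algorithm R d n, (2 <= n)%N ->
    (mean_square_error P X A <= ((Clarge + \sum_(n < n0) Csmall / rate n) * rate n)%:E)%E.
  exists (fun n => projT1 (cid (hA n))) => n n2; rewrite -mulrA.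
  exact: (projT2 (cid (hA n))) n2.
move=> n; have [n2|n2] := ltnP n 2.
  have cube0 (l : 'I_n) : unit_cube [tuple of nseq d (0 : R)].
    by move=> a; rewrite tnth_nseq in_itv /= lexx ler01.
  have L20 (l : 'I_n) : (cst 0 : d.-tuple R -> R) \in Lfun (cube_lebesgue R d) 2%:E.
    exact: Lfun_cst.
  by exists (LinearAlgorithm cube0 L20).
have n_gt0 : (0 < n)%N by exact: leq_trans n2.
have nR0 : 0 < n%:R :> R by rewrite ltr0n.
have l0 : 0 < ln n%:R :> R by rewrite ln_gt0// ltr1n.
have ratio0 (m : 'I_n0) : 0 <= Csmall / rate m.
  by rewrite divr_ge0// mulr_ge0 ?powR_ge0.
have [nn0|n0n] := ltnP n n0.
  (* with threshold 0 the cross is empty and everything belongs to the tail *)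
  have [||A [M [M0 _ hA]]] := algo n 0 (W0 ^+ b) n_gt0 W0b (lexx 0).
  - by rewrite mul0r ler0n.
  - move=> J N Jb; apply: (@le_trans _ _ (\sum_(k : {ffun J -> 'I_N.+1})
        \prod_c (log_weight g (k c) `^ (2 * r)))).
      rewrite big_mkcond; apply: ler_sum => k _; case: ifP => // _.
      by apply: prodr_ge0 => a _; exact: powR_ge0.
    rewrite -(bigA_distr_bigA (fun (a : J) (i : 'I_N.+1) => log_weight g i `^ (2 * r))).
    rewrite prodr_const Jb lerXn2r ?nnegrE ?(ltW W00) ?sumr_ge0// => i _.
    exact: powR_ge0.
  exists A => _; apply: le_trans hA _; rewrite lee_fin NA1.
  apply: (@le_trans _ _ Csmall).
    rewrite /Csmall lerD2l ler_wpM2l// ler_piMr//.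
      by rewrite !mulr_ge0 ?(ltW C0b) ?(ltW W0b).
    by rewrite exprn_ile1 ?subr_ge0 ?invf_le1 ?ler1n ?ltr0n// gerBl invr_ge0.
  apply: (@le_trans _ _ (Csmall / rate n * rate n)).
    by rewrite divfK// gt_eqF// rate0.
  rewrite ler_wpM2r ?(ltW (rate0 n n2))//; apply: ler_wpDl => //.
  exact: (@sumr_ge_term _ _ xpredT (fun m : 'I_n0 => Csmall / rate m) (Ordinal nn0)).
have [h1 h2 h3] := hc n n0n n2.
set Th := c * n%:R * ln n%:R `^ (- (kappa + 1)) in h1 h2 h3.
have Th0 : 0 < Th by apply: lt_le_trans h1; exact: powR_gt0.
pose l : R := ln n%:R; rewrite -/l in l0 h3.
set Sh := \sum_(i < n) log_weight g i.
have Sh0 : 0 <= Sh by apply: sumr_ge0 => i _; rewrite ltW// log_weight_gt0.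
have ShE : Sh ^+ b.-1 <= C1 ^+ b.-1 * l `^ kappa.
  rewrite /kappa powRrM powR_mulrn ?powR_ge0// -exprMn.
  by rewrite lerXn2r ?nnegrE ?mulr_ge0 ?powR_ge0 ?(ltW C10)// hC1.
pose D := C2 * (l `^ (2 * r * g) * Th `^ (1 - 2 * r) * Sh ^+ b.-1 + n%:R `^ (- (3 * (r - 1 / 2)))).
have D0 : 0 < D by rewrite mulr_gt0// ltr_wpDl ?mulr_ge0 ?powR_ge0 ?exprn_ge0// powR_gt0.
have [J N Jb|A [M [M0 hM hA]]] := algo n Th D n_gt0 D0 (ltW Th0) h2.
  by have := hC2 J n Th N Jb n2 h1; rewrite Jb => /(_ h2).
exists A => _; apply: le_trans hA _; rewrite lee_fin NA1.
have hMn : (1 - M%:R^-1) ^+ n <= n%:R `^ (- (2 * r)) :> R.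
  apply: contraction_le => //; apply: le_trans h3; rewrite -/l.
  rewrite ler_wpM2l ?mulr_ge0 ?(ltW r0) ?(ltW l0)//; apply: le_trans hM _.
  rewrite lerD2l -/NA -/Sh (_ : K * _ = NA * (b%:R * (Th * (C1 ^+ b.-1 * l `^ kappa)))).
    by apply: ler_wpM2l => //; apply: ler_wpM2l => //; exact: ler_wpM2l (ltW Th0) _ _ ShE.
  by rewrite /K; ring.
have rateE : rate n = n%:R `^ (1 - 2 * r) * l `^ E by [].
have lE (s Cs : R) : l `^ (- E) <= Cs * n%:R `^ s -> n%:R `^ (- s) <= Cs * l `^ E.
  rewrite !powRN -[X in X <= _ -> _]mul1r -[X in _ -> X <= _]mul1r.
  by rewrite !ler_pdivrMr ?powR_gt0// mulrAC.
have hD : D <= C2 * (C1 ^+ b.-1 * c `^ (1 - 2 * r) + C3) * rate n.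
  rewrite /D -(mulrA C2); apply: ler_wpM2l (ltW C20) _ _ _; rewrite [leRHS]mulrDl; apply: lerD.
    apply: (le_trans (ler_wpM2l _ ShE)); first by rewrite mulr_ge0 ?powR_ge0.
    rewrite /Th !powRM ?(ltW c0) ?(ltW nR0) ?mulr_ge0 ?powR_ge0 ?(ltW c0)//.
    rewrite -powRrM rateE.
    (* the exponent of the theorem: tail, threshold and cardinality combined *)
    have -> : l `^ E = l `^ (2 * r * g) * l `^ (- (kappa + 1) * (1 - 2 * r)) * l `^ kappa.
      rewrite -!powRD ?(gt_eqF l0) ?implybT//; congr (_ `^ _).
      have bE : b.-1%:R = b%:R - 1 :> R by rewrite -[in RHS](prednK b0) -natr1 addrK.
      rewrite /E /kappa bE /g; field; exact: lt0r_neq0.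
    by rewrite le_eqVlt; apply/orP; left; apply/eqP; ring.
  have -> : - (3 * (r - 1 / 2)) = (1 - 2 * r) + (- (r - 1 / 2)) by field.
  rewrite powRD ?(gt_eqF nR0) ?implybT// rateE mulrCA ler_wpM2l ?powR_ge0//.
  by apply: lE; apply: hC3; rewrite ler_nat.
have hN : n%:R `^ (- (2 * r)) <= C4 * rate n.
  have -> : - (2 * r) = (1 - 2 * r) + (- 1) by ring.
  rewrite powRD ?(gt_eqF nR0) ?implybT// rateE mulrCA ler_wpM2l ?powR_ge0//.
  by apply: lE; apply: hC4; rewrite ler_nat.
apply: (@le_trans _ _ (Clarge * rate n)); last first.
  by rewrite ler_wpM2r ?(ltW (rate0 n n2))// lerDl sumr_ge0.
have q1 : 0 <= (NA + 1) * C0 ^+ b by rewrite mulr_ge0 ?addr_ge0 ?(ltW C0b).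
have q2 : 0 <= NA * C0 ^+ b * W0 ^+ b by rewrite !mulr_ge0 ?(ltW C0b) ?(ltW W0b).
have -> : Clarge * rate n =
    12 * ((NA + 1) * C0 ^+ b *
      (C2 * (C1 ^+ b.-1 * c `^ (1 - 2 * r) + C3) * rate n)) +
    4 * (NA * C0 ^+ b * W0 ^+ b * (C4 * rate n)).
  by rewrite /Clarge; move: (rate n) => ?; ring.
apply: lerD; apply: ler_wpM2l => //; apply: ler_wpM2l => //.
exact: le_trans hN.
Qed.
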